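(* Let $p,q\ge0$ be integers with $n=p+q\ge1$. Let $\Omega$ be an open subset of the universal covering of $\mathbb{S}^p\times\mathbb{S}^q$ and $\sigma\in C^4(\Omega)$. Denote by $\tau_i$ the roots of the polynomial of degree $n-1$ given, up to the non-vanishing factor $\det(\tau\,\mathrm{Id}_n+\sigma\,\overline{\mathrm{Id}}_n+2\,\mathrm{Hess}(\sigma))$, by $$P(\tau)=\mathrm{tr}\Big(\big(\tau\,\mathrm{Id}_n+\sigma\,\overline{\mathrm{Id}}_n+2\,\mathrm{Hess}(\sigma)\big)^{-1}\Big).$$ Then the immersions $$\varphi_i:\Omega\to\mathbb{R}^{n+2}_{p+1},\qquad \nu\mapsto\tau_i\,\nu+\sigma\,\overline{\nu}+2\nabla\sigma$$ are marginally trapped. Conversely, any connected, marginally trapped $n$-dimensional submanifold of $\mathbb{R}^{n+2}_{p+1}$, with induced metric of signature $(p,q)$, whose mean Gauss map $\nu$ has maximal rank is the image of such an immersion.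
   Context: $\mathbb{R}^{n+2}_{p+1}$ denotes $\mathbb{R}^{n+2}$ with $\langle\cdot,\cdot\rangle=\sum_{i=1}^{p+1}dx_i^2-\sum_{i=p+2}^{n+2}dx_i^2$. Write $x=(x',x'')\in\mathbb{R}^{p+1}\times\mathbb{R}^{q+1}$ and $\overline{(x',x'')}=(x',-x'')$. $\mathbb{S}^p\times\mathbb{S}^q\subset\mathbb{R}^{p+1}\times\mathbb{R}^{q+1}$ (product of Euclidean unit spheres) carries the metric induced from $\langle\cdot,\cdot\rangle$, of signature $(p,q)$; a point of $\Omega$ is identified with its projection $\nu=(\nu',\nu'')$, and $\Omega$ carries the pulled-back metric. $\nabla\sigma$ is the gradient for this pseudo-Riemannian metric, i.e. $\nabla\sigma=(\nabla'\sigma,-\nabla''\sigma)$ with $\nabla',\nabla''$ the usual gradients on $\mathbb{S}^p,\mathbb{S}^q$. $\mathrm{Hess}(\sigma)$ is the endomorphism $X\mapsto\nabla_X(\nabla\sigma)$ for the Levi-Civita connection of this metric. $\overline{\mathrm{Id}}_n$ is the endomorphism of $T_{\nu'}\mathbb{S}^p\oplus T_{\nu''}\mathbb{S}^q$ equal to $\mathrm{Id}$ on the first factor and $-\mathrm{Id}$ on the second. A root $\tau_i$ means a real-valued function of class $C^2$ on $\Omega$ such that at each point the endomorphism $\tau_i\mathrm{Id}_n+\sigma\overline{\mathrm{Id}}_n+2\mathrm{Hess}(\sigma)$ is invertible and the trace of its inverse vanishes (invertibility being equivalent to non-degeneracy of the metric induced by $\varphi_i$). Submanifolds have codimension two, non-degenerate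 induced metric of signature $(p,q)$, hence Lorentzian two-dimensional normal bundle. The mean curvature vector $\vec H$ is $\frac1n$ times the trace of the second fundamental form; marginally trapped means $\langle\vec H,\vec H\rangle=0$, i.e. $\vec H$ lies in one of the two null lines of the normal space. The mean Gauss map is the null normal vector $\nu=(\nu',\nu'')$ collinear to $\vec H$ and normalized by $\nu\in\mathbb{S}^p\times\mathbb{S}^q$; it has maximal rank if its differential has rank $n$ everywhere.
   Formalization: Converse: the submanifold is covered by images of such immersions, all from one pair σ, τ defined on it; it is the image of a single one if some continuous map from an open Ω onto it inverts ν, e.g. if ν lifts injectively to the covering. Globally it fails when ν covers points many times. *)

(* Defs.v *)
From HB Require Import structures.
From mathcomp Require Export all_boot all_order all_algebra.
From mathcomp Require Export all_classical all_reals all_analysis.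

Export Order.TTheory GRing.Theory Num.Theory.
Export numFieldNormedType.Exports.

Set Implicit Arguments.
Unset Strict Implicit.
Unset Printing Implicit Defensive.

Local Open Scope classical_set_scope.
Local Open Scope ring_scope.

(** ** The ambient space R^(p+1) x R^(q+1) *)

Definition dot (R : realType) (m : nat) (x y : 'rV[R]_m) : R :=
  (x *m y^T) 0 0.

Definition conj_vec (R : realType) (p q : nat) (x : 'rV[R]_(p.+1 + q.+1)) :
    'rV[R]_(p.+1 + q.+1) :=
  row_mx (lsubmx x) (- rsubmx x).

Definition mink (R : realType) (p q : nat) (x y : 'rV[R]_(p.+1 + q.+1)) : R :=
  dot (lsubmx x) (lsubmx y) - dot (rsubmx x) (rsubmx y).

Definition sphere_prod (R : realType) (p q : nat) :
    set 'rV[R]_(p.+1 + q.+1) :=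
  [set y | dot (lsubmx y) (lsubmx y) = 1 /\ dot (rsubmx y) (rsubmx y) = 1].
Arguments sphere_prod R p q : clear implicits.

(** For [y] in [sphere_prod], the projection onto the tangent space of
    S^p x S^q at [y]; it is orthogonal for the Euclidean product and for [mink]
    alike, since the normal space is spanned by (y', 0) and (0, y''). *)
Definition tproj (R : realType) (p q : nat) (y v : 'rV[R]_(p.+1 + q.+1)) :
    'rV[R]_(p.+1 + q.+1) :=
  row_mx (lsubmx v - dot (lsubmx v) (lsubmx y) *: lsubmx y)
         (rsubmx v - dot (rsubmx v) (rsubmx y) *: rsubmx y).

(** The row space of this square matrix is the tangent space at [y]. *)
Definition tangent_mx (R : realType) (p q : nat) (y : 'rV[R]_(p.+1 + q.+1)) :
    'M[R]_(p.+1 + q.+1) :=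
  lin1_mx (tproj y).

(** ** Maps of class C^k on an open set of R^m *)

Fixpoint Ck (R : realType) (m : nat) (V : normedModType R) (k : nat)
    (U : set 'rV[R]_m) (F : 'rV[R]_m -> V) : Prop :=
  match k with
  | 0 => forall u, U u -> {for u, continuous F}
  | k'.+1 => (forall u, U u -> differentiable F u) /\
             (forall i : 'I_m, Ck k' U ('D_(delta_mx 0 i) F))
  end.

(** ** Universal covering *)

Definition is_path (R : realType) (T : topologicalType) (g : R -> T)
    (x y : T) : Prop :=
  [/\ {within `[0, 1], continuous g}, g 0 = x & g 1 = y].

Definition null_homotopic (R : realType) (T : topologicalType) (g : R -> T)
    (x : T) : Prop :=
  exists H : R * R -> T,
    {within `[0, 1] `*` `[0, 1], continuous H} /\
    (forall t : R, t \in `[0, 1] ->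
       [/\ H (0, t) = g t, H (1, t) = x, H (t, 0) = x & H (t, 1) = x]).

Definition covering_map (T E : topologicalType) (S : set E) (pi : T -> E) :
    Prop :=
  [/\ continuous pi, range pi = S &
      forall y, S y -> exists V : set E, [/\ open V, V y &
        exists (I : Type) (W : I -> set T),
        [/\ forall i, open (W i), trivIset setT W,
            pi @^-1` V = \bigcup_i W i &
            forall i, [/\ {in W i &, injective pi}, pi @` W i = V `&` S &
              forall O, open O -> O `<=` W i ->
                exists2 V', open V' & pi @` O = V' `&` S]]]].

(** The base may be disconnected (S^0 has two points), in which case the
    universal covering is taken over each component: two points of a fibre are
    joined by a path, and every loop of [T] is contractible. *)
Definition universal_covering (R : realType) (T E : topologicalType)
    (S : set E) (pi : T -> E) : Prop :=
  [/\ covering_map S pi,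
      forall x y, pi x = pi y -> exists g : R -> T, is_path g x y &
      forall (x : T) (g : R -> T), is_path g x x -> null_homotopic g x].
Arguments universal_covering R {T E} S pi.

(** ** Calculus on a space spread over S^p x S^q

    [pi : T -> R^(n+2)] is (a restriction of) a covering of S^p x S^q and [T]
    carries the differentiable structure pulled back by [pi]: a map on [T] is
    of class C^k when it is locally of the form [F \o pi] with [F] of class C^k
    on an open set of R^(n+2). *)

Definition local_ext (R : realType) (p q : nat) (T : topologicalType)
    (pi : T -> 'rV[R]_(p.+1 + q.+1)) (V : normedModType R) (k : nat)
    (g : T -> V) (w : T) (F : 'rV[R]_(p.+1 + q.+1) -> V) : Prop :=
  exists W : set 'rV[R]_(p.+1 + q.+1),
    [/\ open W, W (pi w), Ck k W F & \forall w' \near w, g w' = F (pi w')].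

Definition Ck_on (R : realType) (p q : nat) (T : topologicalType)
    (pi : T -> 'rV[R]_(p.+1 + q.+1)) (V : normedModType R) (k : nat)
    (Om : set T) (g : T -> V) : Prop :=
  forall w, Om w -> exists F, local_ext pi k g w F.

(** Derivative of [g] at [w] along a vector [X] tangent to S^p x S^q at [pi w]
    (it does not depend on the chosen extension for such [X]). *)
Definition tderiv (R : realType) (p q : nat) (T : topologicalType)
    (pi : T -> 'rV[R]_(p.+1 + q.+1)) (V : normedModType R)
    (g : T -> V) (w : T) (X : 'rV[R]_(p.+1 + q.+1)) : V :=
  'D_X (xget (fun=> 0) [set F | local_ext pi 1 g w F]) (pi w).

(** (nabla' sigma, - nabla'' sigma), with nabla', nabla'' the Euclidean
    gradients on the spheres. *)
Definition grad (R : realType) (p q : nat) (T : topologicalType)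
    (pi : T -> 'rV[R]_(p.+1 + q.+1)) (s : T -> R) (w : T) :
    'rV[R]_(p.+1 + q.+1) :=
  conj_vec (\row_j tderiv pi s w (tproj (pi w) (delta_mx 0 j))).

(** X |-> nabla_X (nabla sigma); the Levi-Civita connection of the metric
    induced by [mink] is the tangential part of the flat connection. *)
Definition hess (R : realType) (p q : nat) (T : topologicalType)
    (pi : T -> 'rV[R]_(p.+1 + q.+1)) (s : T -> R) (w : T)
    (X : 'rV[R]_(p.+1 + q.+1)) : 'rV[R]_(p.+1 + q.+1) :=
  tproj (pi w) (tderiv pi (grad pi s) w X).

(** tau Id + sigma conj(Id) + 2 Hess(sigma), written in a basis of the tangent
    space at [pi w] (whose dimension [\rank (tangent_mx (pi w))] is p + q). *)
Definition root_endo (R : realType) (p q : nat) (T : topologicalType)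
    (pi : T -> 'rV[R]_(p.+1 + q.+1)) (s t : T -> R) (w : T) :
    'M[R]_(\rank (tangent_mx (pi w))) :=
  conjmx (row_base (tangent_mx (pi w)))
    (lin1_mx (fun X => t w *: X + s w *: conj_vec X
                       + (2 : R) *: hess pi s w (tproj (pi w) X))).

Definition is_root (R : realType) (p q : nat) (T : topologicalType)
    (pi : T -> 'rV[R]_(p.+1 + q.+1)) (Om : set T) (s t : T -> R) : Prop :=
  Ck_on pi 2 Om t /\
  forall w, Om w -> root_endo pi s t w \in unitmx /\
                    \tr (invmx (root_endo pi s t w)) = 0.

Definition phi (R : realType) (p q : nat) (T : topologicalType)
    (pi : T -> 'rV[R]_(p.+1 + q.+1)) (s t : T -> R) (w : T) :
    'rV[R]_(p.+1 + q.+1) :=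
  t w *: pi w + s w *: conj_vec (pi w) + (2 : R) *: grad pi s w.

(** ** Immersions of codimension two

    [F] is defined near [u] in R^(p+q), of class C^2 there. *)

Definition metric (R : realType) (p q : nat)
    (F : 'rV[R]_(p + q) -> 'rV[R]_(p.+1 + q.+1)) (u : 'rV[R]_(p + q)) :
    'M[R]_(p + q) :=
  \matrix_(i, j) mink (row i (jacobian F u)) (row j (jacobian F u)).

Definition has_signature (R : realType) (p q : nat) (G : 'M[R]_(p + q)) :
    Prop :=
  exists2 P : 'M[R]_(p + q), P \in unitmx &
    P *m G *m P^T = block_mx (1%:M : 'M[R]_p) 0 0 (- 1%:M : 'M[R]_q).

Definition normal_part (R : realType) (p q : nat)
    (F : 'rV[R]_(p + q) -> 'rV[R]_(p.+1 + q.+1)) (u : 'rV[R]_(p + q))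
    (v : 'rV[R]_(p.+1 + q.+1)) : 'rV[R]_(p.+1 + q.+1) :=
  v - \sum_i \sum_j
        (invmx (metric F u) i j * mink v (row j (jacobian F u)))
          *: row i (jacobian F u).

Definition second_form (R : realType) (p q : nat)
    (F : 'rV[R]_(p + q) -> 'rV[R]_(p.+1 + q.+1)) (u : 'rV[R]_(p + q))
    (i j : 'I_(p + q)) : 'rV[R]_(p.+1 + q.+1) :=
  normal_part F u ('D_(delta_mx 0 j) ('D_(delta_mx 0 i) F) u).

Definition mean_curvature (R : realType) (p q : nat)
    (F : 'rV[R]_(p + q) -> 'rV[R]_(p.+1 + q.+1)) (u : 'rV[R]_(p + q)) :
    'rV[R]_(p.+1 + q.+1) :=
  ((p + q)%:R : R)^-1 *:
    \sum_i \sum_j invmx (metric F u) i j *: second_form F u i j.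

Definition marginally_trapped_at (R : realType) (p q : nat)
    (F : 'rV[R]_(p + q) -> 'rV[R]_(p.+1 + q.+1)) (u : 'rV[R]_(p + q)) :
    Prop :=
  [/\ \rank (jacobian F u) = (p + q)%N, has_signature (metric F u) &
      mink (mean_curvature F u) (mean_curvature F u) = 0].

(** ** Immersed submanifolds

    [f : X -> R^(n+2)] is an immersed submanifold when it is, locally, a
    homeomorphism onto an embedded one; [f] then determines the differentiable
    structure of [X], whose charts are the inverses of the [c] below. *)

Definition local_param (R : realType) (p q : nat) (X : topologicalType)
    (f : X -> 'rV[R]_(p.+1 + q.+1)) (k : nat)
    (U : set 'rV[R]_(p + q)) (c : 'rV[R]_(p + q) -> X) : Prop :=
  [/\ open U, {in U &, injective c},
      forall u, U u -> {for u, continuous c},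
      forall O, open O -> O `<=` U -> open (c @` O) &
      Ck k U (f \o c) /\
      forall u, U u -> \rank (jacobian (f \o c) u) = (p + q)%N].

Definition immersed_submanifold (R : realType) (p q : nat)
    (X : topologicalType) (f : X -> 'rV[R]_(p.+1 + q.+1)) (k : nat) : Prop :=
  [/\ hausdorff_space X, @second_countable X &
      forall x, exists U c, local_param f k U c /\ (c @` U) x].

Definition marginally_trapped_submanifold (R : realType) (p q : nat)
    (X : topologicalType) (f : X -> 'rV[R]_(p.+1 + q.+1)) : Prop :=
  immersed_submanifold f 4 /\
  forall U c, local_param f 4 U c ->
    forall u, U u -> marginally_trapped_at (f \o c) u.

Definition marginally_trapped_immersion (R : realType) (p q : nat)
    (T : topologicalType) (pi : T -> 'rV[R]_(p.+1 + q.+1)) (Om : set T)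
    (ph : T -> 'rV[R]_(p.+1 + q.+1)) : Prop :=
  forall U c, local_param pi 2 U c -> c @` U `<=` Om ->
    Ck 2 U (ph \o c) /\
    forall u, U u -> marginally_trapped_at (ph \o c) u.

(** Where the mean curvature vector vanishes, every null normal direction is
    collinear to it. *)
Definition mean_Gauss_map (R : realType) (p q : nat)
    (X : topologicalType) (f nu : X -> 'rV[R]_(p.+1 + q.+1)) : Prop :=
  forall U c, local_param f 4 U c -> forall u, U u ->
    [/\ sphere_prod R p q (nu (c u)),
        forall i, mink (nu (c u)) (row i (jacobian (f \o c) u)) = 0 &
        exists a : R, mean_curvature (f \o c) u = a *: nu (c u)].

Definition maximal_rank (R : realType) (p q : nat)
    (X : topologicalType) (f nu : X -> 'rV[R]_(p.+1 + q.+1)) : Prop :=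
  forall U c, local_param f 4 U c -> forall u, U u ->
    differentiable (nu \o c) u /\
    \rank (jacobian (nu \o c) u) = (p + q)%N.

(** [h] parametrizes the part [h @` Om] of [X] by its mean Gauss map, the
    latter being lifted to [T]. *)
Definition Gauss_param (R : realType) (p q : nat) (X T : topologicalType)
    (nu : X -> 'rV[R]_(p.+1 + q.+1)) (pi : T -> 'rV[R]_(p.+1 + q.+1))
    (Om : set T) (h : T -> X) : Prop :=
  [/\ open Om, forall w, Om w -> {for w, continuous h} &
      forall w, Om w -> nu (h w) = pi w].

(* Main.v *)
Require Import Defs.
From mathcomp Require Import ring lra.

Set Implicit Arguments.
Unset Strict Implicit.
Unset Printing Implicit Defensive.

Local Open Scope classical_set_scope.
Local Open Scope ring_scope.

(** Write [F] for the immersion in a parametrization, [n] for the map to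
    S^p x S^q in the same parametrization, and [H] for the mean curvature.

    The direct statement rests on one cancellation. Differentiate
    [F = t n + s conj_vec n + 2 grad s] in a direction [X]: the tangential part
    of [2 D_X (grad s)] is [2 Hess s X], and its component along [conj_vec n] is
    [- ds(X) conj_vec n], because [grad s] stays orthogonal to [n]
    ([grad_chain]). This kills the term [ds(X) conj_vec n], so that
    [dF = A dn + a n] for the endomorphism [A] of the statement ([phi_chain]).
    As [n] is null and orthogonal to the tangent space of S^p x S^q, the metric
    induced by [F] is the pull-back by [A] of that of the sphere product, and
    [n] is a normal field of [F]. Differentiating [mink (dF) n = 0] expresses
    the second fundamental form along [n] by first derivatives only, and its
    trace is [mink H n = - tr (A^-1) / (p + q)] ([factorized_curvature]). When
    [t] is a root, [H] is thus orthogonal to [n], hence to the tangent space of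
    S^p x S^q, hence a multiple of the null vector [n] ([normal_null_line]).

    Conversely let [f] be marginally trapped with mean Gauss map [nu]. Pairing
    the desired formula with [nu] and [conj_vec nu] dictates
    [s = mink f nu / 2] and [t = mink f (conj_vec nu) / 2]. As [nu] is normal to
    the submanifold, [ds = mink f (d nu) / 2], that is, [2 grad s] is the
    tangential part of [f] at [nu], which is the formula ([phi_potential]). The
    computation of the direct part then reads backwards: non-degeneracy of the
    metric makes [A] invertible, and [H] being a multiple of [nu] makes the
    trace of its inverse vanish ([root_potential]).

    What remains is regularity and the passage from charts of the submanifold
    to S^p x S^q. In a chart, [nu] is determined by linear equations in the
    first derivatives of [f], so differentiating them repeatedly gives class C^3
    ([Gauss_smooth]). Having maximal rank, it is locally invertible
    ([Gauss_inversion]) with an inverse of class C^3 ([Gauss_inverse_smooth]);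
    hence [s] is C^3 as a function of [nu], and C^4 because the formula for [ds]
    involves no derivative of [f].

    Functions on the covering space are handled through extensions to the
    ambient space. The radial retraction onto S^p x S^q lifts locally to the
    covering ([retract_lift]); its derivative at a point of S^p x S^q is the
    tangential projection ([derive_retract]), which is why the derivative of a
    function along a tangent vector does not depend on the extension
    ([tderiv_ext]). *)

(** * Differentials in normed modules *)

Lemma differentiable_approxP (R : realType) (V W : normedModType R) (g : V -> W)
    (x : V) (dg : {linear V -> W}) : continuous dg ->
  (forall e : R, 0 < e ->
     \forall h \near (0 : V), `|g (h + x) - g x - dg h| <= e * `|h|) ->
  differentiable g x /\ 'd g x = dg :> (V -> W).
Proof.
move=> cdg H.
have E : g \o shift x = cst (g x) + dg +o_ (0:V) id.
  apply/eqaddoP => e e0; near=> h.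
  rewrite /= /GRing.add /GRing.opp /= opprD addrA.
  by near: h; apply: H.
have D := diff_unique cdg E.
split=> //; apply/diff_locallyP; rewrite D; split=> //.
Unshelve. all: by end_near. Qed.

Lemma differentiable_approx (R : realType) (V W : normedModType R) (g : V -> W)
    (x : V) (e : R) : differentiable g x -> 0 < e ->
  \forall h \near (0 : V), `|g (h + x) - g x - 'd g x h| <= e * `|h|.
Proof.
move=> /diff_locally /eqaddoP H e0; near=> h.
have -> : g (h + x) - g x - 'd g x h = (g \o shift x - (cst (g x) + 'd g x)) h.
  by rewrite /= /GRing.add /GRing.opp /= opprD addrA.
by near: h; apply: H.
Unshelve. all: by end_near. Qed.

Lemma near0_shift (R : realType) (V : normedModType R) (x : V) (P : set V) :
  (\forall z \near x, P z) <-> \forall h \near (0 : V), P (h + x).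
Proof.
by rewrite (near_shift 0 x) /=; split; apply: filterS => h /=; rewrite subr0.
Qed.

Lemma near_eq_diff (R : realType) (V W : normedModType R) (f g : V -> W) (x : V) :
  (\near x, f x = g x) -> differentiable f x ->
  differentiable g x /\ 'd g x = 'd f x :> (V -> W).
Proof.
move=> fg df; apply: differentiable_approxP; first exact: diff_continuous.
move=> e e0; rewrite -(nbhs_singleton fg).
have /near0_shift fg0 := fg.
apply: filterS2 fg0 (differentiable_approx df e0) => h <-; exact.
Qed.

Lemma near_always (T : topologicalType) (u : T) (P : set T) :
  (forall v, P v) -> \forall v \near u, P v.
Proof. by move=> H; apply: filterS (@filterT _ (nbhs u) _). Qed.

Lemma row_linear_sum (R : realType) (m : nat) (V : lmodType R)
    (f : 'rV[R]_m -> V) v :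
  (forall x y, f (x + y) = f x + f y) -> (forall a x, f (a *: x) = a *: f x) ->
  f v = \sum_i v 0 i *: f (delta_mx 0 i).
Proof.
move=> fD fZ; rewrite [v in LHS]row_sum_delta.
elim/big_rec2 : _ => [|i x z _ <-]; last by rewrite fD fZ.
by rewrite -[X in f X](scale0r (0 : 'rV[R]_m)) fZ scale0r.
Qed.

Lemma mul_lin1_mx (R : realType) (m n : nat) (f : 'rV[R]_m -> 'rV[R]_n) v :
  (forall x y, f (x + y) = f x + f y) -> (forall a x, f (a *: x) = a *: f x) ->
  v *m lin1_mx f = f v.
Proof.
move=> fD fZ; rewrite (row_linear_sum v fD fZ) mulmx_sum_row.
by apply: eq_bigr => i _; congr (_ *: _); apply/rowP => j; rewrite !mxE.
Qed.

Lemma near_eq_continuous (T U : topologicalType) (F G : T -> U) (u : T) :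
  (\near u, F u = G u) -> {for u, continuous F} -> {for u, continuous G}.
Proof.
move=> FG cF; rewrite /prop_for /continuous_at -(nbhs_singleton FG).
exact: (cvg_trans (near_eq_cvg FG) cF).
Qed.

(** * Functions of class C^k near a point *)

(** The local counterpart of [Ck]: no open set has to be carried along, and
    closure properties are proved by induction on [k] at a fixed point. *)
Fixpoint Ck_at (R : realType) (m : nat) (V : normedModType R) (k : nat)
    (F : 'rV[R]_m -> V) (u : 'rV[R]_m) : Prop :=
  match k with
  | 0 => \forall v \near u, {for v, continuous F}
  | k'.+1 => (\forall v \near u, differentiable F v) /\
             (forall i : 'I_m, Ck_at k' ('D_(delta_mx 0 i) F) u)
  end.

Section Ck_at_basics.
Context (R : realType) (m : nat) (V : normedModType R).
Implicit Types (F G : 'rV[R]_m -> V) (u : 'rV[R]_m).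

Lemma Ck_at_near_eq k F G u : (\near u, F u = G u) -> Ck_at k F u -> Ck_at k G u.
Proof.
elim: k F G => [|k IH] F G FG /=.
  apply: filterS2 (near_join FG) => v; exact: near_eq_continuous.
case=> dF pF; split=> [|i].
  by apply: filterS2 (near_join FG) dF => v FGv dFv; have [] :=
    near_eq_diff FGv dFv.
apply: IH (pF i); apply: filterS (near_join FG) => v; exact: near_eq_derive.
Qed.

Lemma Ck_at_continuous k F u : Ck_at k F u -> \forall v \near u, {for v,
  continuous F}.
Proof.
by case: k => //= k [dF _]; apply: filterS dF => v;
  exact: differentiable_continuous.
Qed.

Lemma Ck_at_le k l F u : (k <= l)%N -> Ck_at l F u -> Ck_at k F u.
Proof.
elim: l k F => [|l IH] [|k] F //=.
  by move=> _ H; exact: (@Ck_at_continuous l.+1).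
by rewrite ltnS => kl [dF pF]; split=> // i; exact: IH (pF i).
Qed.

Lemma Ck_at_diff k F u : Ck_at k.+1 F u -> differentiable F u.
Proof. by case=> /nbhs_singleton. Qed.

Lemma Ck_at_near k F u : Ck_at k F u -> \forall v \near u, Ck_at k F v.
Proof.
elim: k F => [|k IH] F /=; first exact: near_join.
case=> dF pF.
have pF' : \forall v \near u, forall i : 'I_m, Ck_at k ('D_(delta_mx 0 i) F) v.
  apply: (@filter_forall 'rV[R]_m 'I_m
    (fun i v => Ck_at k ('D_(delta_mx 0 i) F) v) (nbhs u)) => i.
  exact: IH.
exact: filterI (near_join dF) pF'.
Qed.

Lemma Ck_atP k U F : open U -> (Ck k U F <-> forall u, U u -> Ck_at k F u).
Proof.
move=> oU.
have nU u : U u -> \forall v \near u, U v by move=> Uu; exact: open_nbhs_nbhs.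
elim: k F => [|k IH] F /=.
  split=> H u Uu; last exact: nbhs_singleton (H u Uu).
  by apply: filterS (nU _ Uu) => v; exact: H.
split=> [[dF pF] u Uu|H].
  by split=> [|i]; [apply: filterS (nU _ Uu) => v; exact: dF|have /IH := pF i;
    exact].
split=> [u Uu|i]; first exact: nbhs_singleton (proj1 (H u Uu)).
by apply/IH => u /H [].
Qed.

Lemma Ck_at_openP k F u :
  Ck_at k F u <-> exists W : set 'rV[R]_m, [/\ open W, W u & Ck k W F].
Proof.
split=> [H|[W [oW Wu /(Ck_atP _ _ oW)]]]; last exact.
exists (interior [set v | Ck_at k F v]); split.
- exact: open_interior.
- exact: Ck_at_near.
- by apply/(Ck_atP _ _ (@open_interior _ _)) => v; exact: nbhs_singleton.
Qed.

Lemma Ck_at_cst k (a : V) u : Ck_at k (fun=> a) u.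
Proof.
elim: k a => [|k IH] a /=; first by apply: near_always => v; exact: cst_continuous.
split; first by apply: near_always => v; exact: differentiable_cst.
move=> i; apply: (Ck_at_near_eq _ (IH 0)); apply: near_always => v.
by rewrite derive_cst.
Qed.

Lemma Ck_at_add k F G u : Ck_at k F u -> Ck_at k G u ->
  Ck_at k (fun v => F v + G v) u.
Proof.
elim: k F G => [|k IH] F G /=.
  by apply: filterS2 => v; exact: continuousD.
move=> [dF pF] [dG pG]; split.
  by apply: filterS2 dF dG => v; exact: differentiableD.
move=> i; apply: Ck_at_near_eq (IH _ _ (pF i) (pG i)).
by apply: filterS2 dF dG => v dFv dGv; rewrite deriveD //; exact: diff_derivable.
Qed.

End Ck_at_basics.

Lemma derive_comp (R : realType) (U V W : normedModType R) (F : V -> W) (G : U -> V)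
    (u x : U) : differentiable G x -> differentiable F (G x) ->
  'D_u (F \o G) x = 'D_('D_u G x) F (G x).
Proof.
move=> dG dF; rewrite (deriveE _ (differentiable_comp dG dF)) (diff_comp dG dF) /=.
by rewrite -(deriveE _ dG) (deriveE _ dF).
Qed.

Lemma derive_sqrt_comp (R : realType) (V : normedModType R) (f : V -> R) (u x : V) :
  differentiable f x -> 0 < f x ->
  differentiable (fun v => Num.sqrt (f v)) x /\
  'D_u (fun v => Num.sqrt (f v)) x = (2 * Num.sqrt (f x))^-1 * 'D_u f x.
Proof.
move=> df f0.
have ds : differentiable (@Num.sqrt R) (f x).
  by apply/derivable1_diffP; have [] := is_derive1_sqrt f0.
split; first exact: (differentiable_comp df ds).
rewrite (derive_comp u df ds) (deriveE _ ds).
have -> : 'D_u f x = ('D_u f x) *: (1 : R) by rewrite /GRing.scale /= mulr1.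
rewrite linearZ /= -[X in _ *: X](deriveE _ ds) derive_sqrt //.
by rewrite /GRing.scale /= mulr1 mulrC.
Qed.

Section Ck_at_scalar.
Context (R : realType) (m : nat).
Implicit Types (f g : 'rV[R]_m -> R) (u : 'rV[R]_m).

Lemma Ck_at_mul k f g u : Ck_at k f u -> Ck_at k g u ->
  Ck_at k (fun v => f v * g v) u.
Proof.
elim: k f g => [|k IH] f g.
  by apply: filterS2 => v; exact: continuousM.
move=> Cf Cg; have [df pf] := Cf; have [dg pg] := Cg; split.
  by apply: filterS2 df dg => v; exact: differentiableM.
move=> i.
have H : Ck_at k (fun v => f v * 'D_(delta_mx 0 i) g v +
                           g v * 'D_(delta_mx 0 i) f v) u.
  have Cf' := Ck_at_le (leqnSn k) Cf; have Cg' := Ck_at_le (leqnSn k) Cg.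
  by apply: Ck_at_add; apply: IH => //; [exact: pg|exact: pf].
apply: Ck_at_near_eq H.
apply: filterS2 df dg => v dfv dgv.
by rewrite deriveM //; exact: diff_derivable.
Qed.

Lemma Ck_at_inv k f u : f u != 0 -> Ck_at k f u -> Ck_at k (fun v => (f v)^-1) u.
Proof.
move=> fu0; elim: k => [|k IH] Cf.
  have fn0 : \forall v \near u, f v != 0.
    by apply: (@cvgr_neq0 _ _ _ (nbhs u) _ f (f u)) => //;
      exact: (nbhs_singleton Cf).
  by apply: filterS2 fn0 Cf => v fv; exact: continuousV.
have [df pf] := Cf.
have fn0 : \forall v \near u, f v != 0.
  apply: (@cvgr_neq0 _ _ _ (nbhs u) _ f (f u)) => //.
  exact: (nbhs_singleton (Ck_at_continuous Cf)).
split; first by apply: filterS2 df fn0 => v; exact: differentiableV.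
move=> i; have Ci := IH (Ck_at_le (leqnSn k) Cf).
have H : Ck_at k (fun v => -1 * ((f v)^-1 * (f v)^-1) * 'D_(delta_mx 0 i) f v) u.
  apply: Ck_at_mul; last exact: pf.
  by apply: Ck_at_mul; [exact: Ck_at_cst|exact: Ck_at_mul].
apply: Ck_at_near_eq H.
apply: filterS2 df fn0 => v dfv fv.
rewrite deriveV //; last exact: diff_derivable.
by rewrite expr2 invfM mulN1r.
Qed.

Lemma Ck_at_sqrt k f u : 0 < f u -> Ck_at k f u -> Ck_at k
  (fun v => Num.sqrt (f v)) u.
Proof.
move=> fu0; elim: k => [|k IH] Cf.
  apply: filterS Cf => v Cf; apply: (@continuous_comp _ _ _ f) => //.
  exact: sqrt_continuous.
have [df pf] := Cf.
have fn0 : \forall v \near u, 0 < f v.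
  apply: (@cvgr_gt _ _ (nbhs u) _ f (f u)) => //.
  exact: (nbhs_singleton (Ck_at_continuous Cf)).
split.
  by apply: filterS2 df fn0 => v dfv fv; have [] := derive_sqrt_comp 0 dfv fv.
move=> i; have Ci := IH (Ck_at_le (leqnSn k) Cf).
have H : Ck_at k (fun v => (2 * Num.sqrt (f v))^-1 * 'D_(delta_mx 0 i) f v) u.
  apply: Ck_at_mul; last exact: pf.
  apply: Ck_at_inv.
    by rewrite mulf_neq0 // gt_eqF // sqrtr_gt0.
  by apply: Ck_at_mul => //; exact: Ck_at_cst.
apply: Ck_at_near_eq H.
by apply: filterS2 df fn0 => v dfv fv; have [_ ->] :=
  derive_sqrt_comp (delta_mx 0 i) dfv fv.
Qed.

End Ck_at_scalar.

(** * Matrix-valued functions of class C^k *)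

Section matrix_valued.
Context (R : realType) (a b : nat).

Lemma continuous_mxP (T : topologicalType) (F : T -> 'M[R]_(a, b)) (u : T) :
  {for u, continuous F} <-> forall i j, {for u, continuous (fun v => F v i j)}.
Proof.
split=> [cF i j|H].
  by apply: (@continuous_comp _ _ _ F (fun M => M i j)) => //;
    exact: coord_continuous.
move=> A [P HP sPA]; rewrite /=.
have HF : \forall v \near u, forall ij : 'I_a * 'I_b, P ij.1 ij.2 (F v ij.1 ij.2).
  apply: (@filter_forall T _ (fun (ij : 'I_a * 'I_b) v => P ij.1 ij.2 (F v ij.1
    ij.2)) (nbhs u)).
  by move=> [i j]; apply: (H i j); exact: HP.
by apply: filterS HF => v Hv; apply: sPA => i j; exact: (Hv (i, j)).
Qed.

Lemma differentiable_mxP (V : normedModType R) (F : V -> 'M[R]_(a, b)) (u : V) :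
  differentiable F u <-> forall i j, differentiable (fun v => F v i j) u.
Proof.
split=> [dF i j|H].
  by apply: (@differentiable_comp _ _ _ _ F (fun M => M i j)) => //;
    exact: differentiable_coord.
have -> : F = \sum_i \sum_j (fun v => F v i j *: (delta_mx i j : 'M[R]_(a, b))).
  apply/funext => v; rewrite fct_sumE [LHS]matrix_sum_delta.
  by apply: eq_bigr => i _; rewrite fct_sumE.
apply: differentiable_sum => i; apply: differentiable_sum => j.
by apply: (@differentiableZl _ _ _ (fun v => F v i j)); exact: H.
Qed.

Lemma derive_coord (V : normedModType R) (F : V -> 'M[R]_(a, b)) (u x : V) i j :
  differentiable F u -> ('D_x F u) i j = 'D_x (fun v => F v i j) u.
Proof. by move=> dF; rewrite derive_mx ?mxE //; exact: diff_derivable. Qed.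

Lemma Ck_at_mxP (m k : nat) (F : 'rV[R]_m -> 'M[R]_(a, b)) u :
  Ck_at k F u <-> forall i j, Ck_at k (fun v => F v i j) u.
Proof.
elim: k F => [|k IH] F /=.
  split=> [H i j|H]; first by apply: filterS H => v /continuous_mxP.
  have : \forall v \near u, forall ij : 'I_a * 'I_b, {for v,
    continuous (fun v => F v ij.1 ij.2)}.
    apply: (@filter_forall _ _ (fun (ij : 'I_a * 'I_b) v => {for v,
      continuous (fun v => F v ij.1 ij.2)}) (nbhs u)).
    by move=> [i j]; exact: H.
  by apply: filterS => v Hv; apply/continuous_mxP => i j; exact: (Hv (i, j)).
split=> [[dF pF] i j|H].
  split; first by apply: filterS dF => v /differentiable_mxP.
  move=> l; have /IH/(_ i j) := pF l.
  by apply: Ck_at_near_eq; apply: filterS dF => v dFv; rewrite derive_coord.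
have dF : \forall v \near u, differentiable F v.
  have : \forall v \near u, forall ij : 'I_a * 'I_b,
    differentiable (fun v => F v ij.1 ij.2) v.
    apply: (@filter_forall _ _ (fun (ij : 'I_a * 'I_b) v => differentiable (fun v
      => F v ij.1 ij.2) v) (nbhs u)).
    by move=> [i j]; exact: (H i j).1.
  by apply: filterS => v Hv; apply/differentiable_mxP => i j; exact: (Hv (i, j)).
split=> // l; apply/IH => i j.
have := (H i j).2 l; apply: Ck_at_near_eq.
by apply: filterS dF => v dFv; rewrite derive_coord.
Qed.

End matrix_valued.

Section matrix_operations.
Context (R : realType) (m : nat).
Implicit Types u : 'rV[R]_m.

Lemma Ck_at_sum k (I : Type) (r : seq I) (P : pred I) (F : I -> 'rV[R]_m -> R) u :
  (forall i, Ck_at k (F i) u) -> Ck_at k (fun v => \sum_(i <- r | P i) F i v) u.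
Proof.
move=> H; elim: r => [|i r IH].
  apply: Ck_at_near_eq (@Ck_at_cst R m R k 0 u); apply: near_always => v.
  by rewrite big_nil.
have Hi : Ck_at k (fun v => (if P i then F i v else 0) + \sum_(j <- r | P j) F j
  v) u.
  by apply: Ck_at_add => //; case: (P i); [exact: H|exact: Ck_at_cst].
apply: Ck_at_near_eq Hi; apply: near_always => v.
by rewrite big_cons; case: (P i); rewrite ?add0r.
Qed.

Lemma Ck_at_prod k (I : Type) (r : seq I) (P : pred I) (F : I -> 'rV[R]_m -> R) u :
  (forall i, Ck_at k (F i) u) -> Ck_at k (fun v => \prod_(i <- r | P i) F i v) u.
Proof.
move=> H; elim: r => [|i r IH].
  apply: Ck_at_near_eq (@Ck_at_cst R m R k 1 u); apply: near_always => v.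
  by rewrite big_nil.
have Hi : Ck_at k (fun v => (if P i then F i v else 1) * \prod_(j <- r | P j) F j
  v) u.
  by apply: Ck_at_mul => //; case: (P i); [exact: H|exact: Ck_at_cst].
apply: Ck_at_near_eq Hi; apply: near_always => v.
by rewrite big_cons; case: (P i); rewrite ?mul1r.
Qed.

Lemma Ck_at_mulmx k a b c (A : 'rV[R]_m -> 'M[R]_(a, b))
  (B : 'rV[R]_m -> 'M[R]_(b, c)) u :
  Ck_at k A u -> Ck_at k B u -> Ck_at k (fun v => A v *m B v) u.
Proof.
move=> /Ck_at_mxP HA /Ck_at_mxP HB; apply/Ck_at_mxP => i j.
have H : Ck_at k (fun v => \sum_l A v i l * B v l j) u.
  by apply: Ck_at_sum => l; exact: Ck_at_mul.
by apply: Ck_at_near_eq H; apply: near_always => v; rewrite mxE.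
Qed.

Lemma Ck_at_trmx k a b (A : 'rV[R]_m -> 'M[R]_(a, b)) u :
  Ck_at k A u -> Ck_at k (fun v => (A v)^T) u.
Proof.
move=> /Ck_at_mxP HA; apply/Ck_at_mxP => i j.
by apply: Ck_at_near_eq (HA j i); apply: near_always => v; rewrite mxE.
Qed.

Lemma Ck_at_scale k a b (f : 'rV[R]_m -> R) (A : 'rV[R]_m -> 'M[R]_(a, b)) u :
  Ck_at k f u -> Ck_at k A u -> Ck_at k (fun v => f v *: A v) u.
Proof.
move=> Hf /Ck_at_mxP HA; apply/Ck_at_mxP => i j.
have H := Ck_at_mul Hf (HA i j).
by apply: Ck_at_near_eq H; apply: near_always => v; rewrite mxE.
Qed.

Lemma Ck_at_det k n (A : 'rV[R]_m -> 'M[R]_n) u :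
  Ck_at k A u -> Ck_at k (fun v => \det (A v)) u.
Proof.
move=> /Ck_at_mxP HA.
rewrite /determinant; apply: Ck_at_sum => s; apply: Ck_at_mul;
  first exact: Ck_at_cst.
by apply: Ck_at_prod => i; exact: HA.
Qed.

Lemma Ck_at_invmx k n (A : 'rV[R]_m -> 'M[R]_n) u :
  A u \in unitmx -> Ck_at k A u -> Ck_at k (fun v => invmx (A v)) u.
Proof.
move=> Au HA.
have Hdet := Ck_at_det HA.
have det0 : \det (A u) != 0 by rewrite -unitfE -unitmxE.
have nu : \forall v \near u, \det (A v) != 0.
  by apply: (@cvgr_neq0 _ _ _ (nbhs u) _ (fun v => \det (A v)) _ _ det0);
    exact: (nbhs_singleton (Ck_at_continuous Hdet)).
have H : Ck_at k (fun v => (\det (A v))^-1 *: \adj (A v)) u.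
  apply: Ck_at_scale; first exact: Ck_at_inv.
  apply/Ck_at_mxP => i j.
  have Hc : Ck_at k (fun v => cofactor (A v) j i) u.
    apply: Ck_at_mul; first exact: Ck_at_cst.
    apply: Ck_at_det; apply/Ck_at_mxP => i' j'.
    move/Ck_at_mxP: HA => /(_ (lift j i') (lift i j')).
    by apply: Ck_at_near_eq; apply: near_always => v; rewrite !mxE.
  by apply: Ck_at_near_eq Hc; apply: near_always => v; rewrite mxE.
apply: Ck_at_near_eq H; apply: filterS nu => v dv.
by rewrite /invmx unitmxE unitfE dv.
Qed.

Lemma Ck_at_proj k i u : Ck_at k (fun v : 'rV[R]_m => v 0 i) u.
Proof.
case: k => [|k] /=; first by apply: near_always => v; exact: coord_continuous.
split; first by apply: near_always => v; exact: differentiable_coord.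
move=> j; apply: Ck_at_near_eq (Ck_at_cst k ((delta_mx 0 j : 'rV[R]_m) 0 i) u).
apply: near_always => v.
by rewrite -(@derive_coord _ _ _ _ id) // derive_id.
Qed.

Lemma Ck_at_id k u : Ck_at k id u.
Proof. by apply/Ck_at_mxP => i j; rewrite ord1; exact: Ck_at_proj. Qed.

End matrix_operations.

Lemma derive_coord_sum (R : realType) m n (F : 'rV[R]_m -> R)
  (G : 'rV[R]_n -> 'rV[R]_m) (u x : 'rV[R]_n) :
  differentiable G x -> differentiable F (G x) ->
  'D_u (F \o G) x = \sum_i ('D_u G x) 0 i * 'D_(delta_mx 0 i) F (G x).
Proof.
move=> dG dF; rewrite (derive_comp u dG dF) (deriveE _ dF).
rewrite [X in 'd F _ X]row_sum_delta linear_sum /=.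
by apply: eq_bigr => i _; rewrite linearZ /= (deriveE _ dF).
Qed.

Lemma Ck_at_comp_scalar (R : realType) m k n (F : 'rV[R]_m -> R)
  (G : 'rV[R]_n -> 'rV[R]_m) (u : 'rV[R]_n) :
  Ck_at k G u -> Ck_at k F (G u) -> Ck_at k (F \o G) u.
Proof.
elim: k F => [|k IH] F CG CF.
  have cGu : G v @[v --> u] --> G u by exact: (nbhs_singleton CG).
  have := cGu _ CF.
  by apply: filterS2 CG => v cG cF; exact: continuous_comp.
have cGu : G v @[v --> u] --> G u by exact: (nbhs_singleton (Ck_at_continuous CG)).
have [dG pG] := CG; have [dF pF] := CF.
have dFG := cGu _ dF; split.
  by apply: filterS2 dG dFG => v; exact: differentiable_comp.
move=> i.
have H : Ck_at k (fun v => \sum_l ('D_(delta_mx 0 i) G v) 0 l * ('D_(delta_mx 0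
  l) F \o G) v) u.
  apply: Ck_at_sum => l; apply: Ck_at_mul; first by have /Ck_at_mxP := pG i; exact.
  by apply: IH; [exact: Ck_at_le CG|exact: pF].
apply: Ck_at_near_eq H; apply: filterS2 dG dFG => v dGv dFv.
by rewrite derive_coord_sum.
Qed.

Lemma Ck_at_comp (R : realType) (m n a b k : nat) (F : 'rV[R]_m -> 'M[R]_(a, b))
    (G : 'rV[R]_n -> 'rV[R]_m) u :
  Ck_at k G u -> Ck_at k F (G u) -> Ck_at k (F \o G) u.
Proof.
move=> CG /Ck_at_mxP CF; apply/Ck_at_mxP => i j.
exact: Ck_at_comp_scalar CG (CF i j).
Qed.

(** * Inverse functions *)

Lemma coord_le_norm (R : realType) (m : nat) (v : 'rV[R]_m) i : `|v 0 i| <= `|v|.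
Proof.
rewrite [leRHS]/Num.Def.normr /= mx_normrE.
exact: (@le_bigmax _ _ _ 0 (fun ij => `|v ij.1 ij.2|) (0, i)).
Qed.

Lemma norm_le_coord (R : realType) (m : nat) (v : 'rV[R]_m) (c : R) :
  0 <= c -> (forall i, `|v 0 i| <= c) -> `|v| <= c.
Proof.
move=> c0 H; rewrite [leLHS]/Num.Def.normr /= mx_normrE.
by apply: bigmax_le => // -[i j] _ /=; rewrite ord1.
Qed.

Lemma closed_ball_near (R : realType) (m : nat) (u : 'rV[R]_m) (P : set 'rV[R]_m) :
  (\forall v \near u, P v) -> exists2 r : R, 0 < r & forall v, `|v - u| <= r -> P v.
Proof.
move=> /nbhs_ballP[e /= e0 He]; exists (e / 2); first exact: divr_gt0.
move=> v vu; apply: He; rewrite -ball_normE /= distrC.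
by apply: le_lt_trans vu _; rewrite gtr_pMr // invf_lt1 // ltr1n.
Qed.

Lemma near_closed_ball (R : realType) (V : normedModType R) (u : V) (r : R) :
  0 < r -> \forall v \near u, `|v - u| <= r.
Proof.
move=> r0; apply/nbhs_ballP; exists r => //= v.
by rewrite -ball_normE /= distrC => /ltW.
Qed.

Lemma mean_value_bound (R : realType) (m : nat) (h : 'rV[R]_m -> R) (u : 'rV[R]_m)
    (r e : R) :
  (forall v, `|v - u| <= r ->
     differentiable h v /\ forall i, `|'D_(delta_mx 0 i) h v| <= e) ->
  forall x y, `|x - u| <= r -> `|y - u| <= r ->
  `|h x - h y| <= m%:R * e * `|x - y|.
Proof.
move=> H x y xr yr.
pose g (t : R) : 'rV[R]_m := t *: (x - y) + y.
have gr (t : R) : t \in `[0, 1] -> `|g t - u| <= r.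
  rewrite in_itv /= => /andP[t0 t1].
  have -> : g t - u = t *: (x - u) + (1 - t) *: (y - u).
    rewrite /g; apply/matrixP => a b; rewrite !mxE; ring.
  apply: (le_trans (ler_normD _ _)); rewrite !normrZ !ger0_norm ?subr_ge0 //.
  have -> : r = t * r + (1 - t) * r by ring.
  by rewrite lerD // ler_wpM2l // subr_ge0.
have dg (t : R) : differentiable g t /\ 'd g t 1 = x - y.
  have [dgt Dgt] := is_diffD (is_diff_scalel t (x - y)) (is_diff_cst y t).
  by split=> //; rewrite Dgt /GRing.add /= addr0 scale1r.
have dhg (t : R) : t \in `[0, 1] -> is_derive t 1 (h \o g) ('D_(x - y) h (g t)).
  move=> /gr /H [dh _]; have [dgt Dgt] := dg t.
  have dc : differentiable (h \o g) t := differentiable_comp dgt dh.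
  apply: DeriveDef; first exact: diff_derivable.
  by rewrite (deriveE _ dc) (diff_comp dgt dh) /= Dgt -deriveE.
pose dh (t : R) : R := 'D_(x - y) h (g t).
have ch : {within `[0, 1], continuous (h \o g)}.
  by apply: derivable_within_continuous => t /dhg [].
have dho (t : R) : t \in `]0, 1[%R -> is_derive t 1 (h \o g) (dh t).
  by rewrite in_itv /= => /andP[t0 t1]; apply: dhg; rewrite in_itv /= !ltW.
have [c c01] := @MVT_segment R (h \o g) dh 0 1 ler01 dho ch.
rewrite /dh /= {1 2}/g scale1r scale0r subrK add0r subr0 mulr1 => ->.
have [dhc Dh] := H _ (gr _ c01).
rewrite deriveE // [X in 'd h _ X]row_sum_delta linear_sum /=.
apply: (le_trans (ler_norm_sum _ _ _)).
have -> : m%:R * e * `|x - y| = \sum_(i < m) `|x - y| * e.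
  by rewrite sumr_const card_ord -mulr_natl; ring.
apply: ler_sum => i _; rewrite linearZ /= -deriveE // normrM ler_pM //.
exact: coord_le_norm.
Qed.

(** Continuity of the partial derivatives makes [G - id] a contraction near a
    point where its differential vanishes. Further local conditions can be
    imposed on the ball through [P]. *)
Lemma strict_differentiability (R : realType) (n : nat) (G : 'rV[R]_n -> 'rV[R]_n)
    (u : 'rV[R]_n) (P : set 'rV[R]_n) :
  Ck_at 1 G u -> (forall i, 'D_(delta_mx 0 i) G u = delta_mx 0 i) ->
  (\forall v \near u, P v) ->
  exists2 r : R, 0 < r &
    (forall v, `|v - u| <= r -> P v /\ differentiable G v) /\
    forall x y, `|x - u| <= r -> `|y - u| <= r ->
      `|G x - G y - (x - y)| <= 2^-1 * `|x - y|.
Proof.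
move=> CG DG nP.
pose h j (v : 'rV[R]_n) := G v 0 j + (- 1) * v 0 j.
have Ch j : Ck_at 1 (h j) u.
  apply: Ck_at_add; first by move/Ck_at_mxP: CG => /(_ 0 j).
  by apply: Ck_at_mul; [exact: Ck_at_cst|exact: Ck_at_proj].
have Dh i j : 'D_(delta_mx 0 i) (h j) u = 0.
  have dG := Ck_at_diff CG.
  have dGj : differentiable (fun v => G v 0 j) u by move/differentiable_mxP : dG;
    exact.
  have -> : h j = (fun v => G v 0 j) - (fun v => v 0 j).
    by apply/funext => v; rewrite /h mulN1r.
  rewrite deriveB; last 2 first.
  - exact: diff_derivable.
  - by apply: diff_derivable; exact: differentiable_coord.
  by rewrite -(@derive_coord _ _ _ _ G u _ 0 j dG) DG -(@derive_coord _ _ _ _ id)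
    // derive_id subrr.
(* [n.+1] instead of [n], so that [e] makes sense for [n = 0]. *)
pose e : R := (2 * (n.+1)%:R)^-1.
have e0 : 0 < e by rewrite invr_gt0 mulr_gt0 // ltr0n.
have small : \forall v \near u, forall ij : 'I_n * 'I_n,
    `|'D_(delta_mx 0 ij.1) (h ij.2) v| <= e.
  apply: (@filter_forall _ _ (fun (ij : 'I_n * 'I_n) v => `|'D_(delta_mx 0 ij.1)
    (h ij.2) v| <= e) (nbhs u)).
  move=> [i j] /=; have [_ /(_ i) /nbhs_singleton c] := Ch j.
  have /cvgrPdist_le/(_ e e0) := c; rewrite Dh; apply: filterS => v.
  by rewrite sub0r normrN.
have dh : \forall v \near u, forall j, differentiable (h j) v.
  apply: (@filter_forall _ _ (fun j v => differentiable (h j) v) (nbhs u)) => j.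
  by have [] := Ch j.
have [dG _] := CG.
have [r r0 Hr] := closed_ball_near (filterI (filterI nP dG) (filterI small dh)).
exists r => //; split=> [v /Hr[[? ?]]//|x y xr yr].
apply: norm_le_coord => [|j]; first by rewrite mulr_ge0.
have -> : (G x - G y - (x - y)) 0 j = h j x - h j y by rewrite /h !mxE; ring.
have H := @mean_value_bound R n (h j) u r e _ x y xr yr.
apply: le_trans (H _) _ => [v /Hr[_ [He Hd]]|].
  by split=> [|i]; [exact: Hd|exact: (He (i, j))].
apply: ler_wpM2r => //; rewrite /e invfM mulrCA -[leRHS]mulr1 ler_wpM2l //.
by rewrite ler_pdivrMr ?ltr0n // mul1r ler_nat.
Qed.

Lemma near_identity_expands (R : realType) (n : nat) (x y a b : 'rV[R]_n) :
  `|a - b - (x - y)| <= 2^-1 * `|x - y| -> `|x - y| <= 2 * `|a - b|.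
Proof.
move=> H; have : `|x - y| <= `|a - b| + `|a - b - (x - y)|.
  by rewrite -{1}[x - y](subKr (a - b)); exact: ler_normB.
by move: H; set p := `|x - y|; set q := `|a - b|; set s := `|_ - _|; lra.
Qed.

(** Moving a minimiser [x] of the distance from [G x] to [y] by the remaining
    error [G x - y] at least halves that error, so it must vanish. The bound
    [r / 5] keeps the moved point in the ball: a minimiser is within [4 r / 5]
    of [u] and the error is at most [r / 5]. *)
Lemma near_identity_onto (R : realType) (n : nat) (G : 'rV[R]_n -> 'rV[R]_n)
    (u : 'rV[R]_n) (r : R) : 0 < r ->
  (forall v, `|v - u| <= r -> {for v, continuous G}) ->
  (forall x y, `|x - u| <= r -> `|y - u| <= r ->
      `|G x - G y - (x - y)| <= 2^-1 * `|x - y|) ->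
  forall y, `|y - G u| <= r / 5 -> exists2 x, `|x - u| <= r & G x = y.
Proof.
move=> r0 cG H y yr.
pose A : set 'rV[R]_n := [set x | `|x - u| <= r].
have Au : A u by rewrite /A /= subrr normr0 ltW.
have cA : compact A.
  apply: bounded_closed_compact.
    exists (`|u| + r); split; first exact: num_real.
    move=> M HM x Ax; apply: ltW; apply: le_lt_trans HM.
    rewrite -[x](subrK u) addrC; apply: le_trans (ler_normD _ _) _.
    by rewrite lerD2l.
  have -> : A = closed_ball u r.
    by rewrite closed_ballE //; apply/seteqP; split=> x;
      rewrite /closed_ball_ /= distrC.
  exact: closed_ball_closed.
have cf : {within A, continuous (fun x => `|G x - y|)}.
  apply: continuous_in_subspaceT => x; rewrite inE => Ax.
  apply: (@continuous_comp _ _ _ (fun x => G x - y) (fun z => `|z|)).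
    by apply: continuousB; [exact: cG|exact: cst_continuous].
  exact: norm_continuous.
have [x] := @EVT_min_rV R n _ A (ex_intro _ u Au) cA cf.
rewrite inE => Ax minx; exists x => //; apply/eqP; rewrite -subr_eq0 -normr_eq0.
set d := `|G x - y|.
have dr : d <= r / 5.
  by apply: le_trans (minx u _) _; rewrite ?inE // distrC.
have xu : `|x - u| <= 4 / 5 * r.
  apply: le_trans (near_identity_expands (H _ _ Ax Au)) _.
  have : `|G x - G u| <= d + `|y - G u| by exact: ler_distD.
  by move: dr yr; set q := `|_ - _|; set s := `|G x - _|; lra.
have Az : A (x - (G x - y)).
  rewrite /A /= addrAC; apply: le_trans (ler_normB _ _) _; rewrite -/d.
  by move: dr xu; set q := `|_ - _|; lra.
have := minx _ (mem_set Az); rewrite -/d.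
have -> : G (x - (G x - y)) - y = - (G x - G (x - (G x - y)) - (x - (x - (G x -
  y)))).
  rewrite subKr; move: (G (x - (G x - y))) => b; move: (G x) => a.
  by rewrite [RHS]opprB opprB [RHS]addrC addrA subrK.
rewrite normrN => dd; have := le_trans dd (H _ _ Ax Az).
rewrite subKr -/d => d2.
by rewrite eq_le normr_ge0 andbT; move: d2; rewrite -/d; lra.
Qed.

Lemma row_jacobian (R : realType) (m n : nat) (F : 'rV[R]_m -> 'rV[R]_n) u i :
  differentiable F u -> row i (jacobian F u) = 'D_(delta_mx 0 i) F u.
Proof. by move=> dF; rewrite deriveEjacobian // rowE. Qed.

Lemma Ck_at_jacobian (R : realType) (m n k : nat) (F : 'rV[R]_m -> 'rV[R]_n) u :
  Ck_at k.+1 F u -> Ck_at k (jacobian F) u.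
Proof.
move=> [dF pF]; apply/Ck_at_mxP => i j.
have /Ck_at_mxP/(_ 0 j) := pF i; apply: Ck_at_near_eq.
by apply: filterS dF => v dFv; rewrite -row_jacobian // mxE.
Qed.

Lemma mulmxr_continuous (R : realType) (m n : nat) (A : 'M[R]_(m, n)) :
  continuous (fun v : 'rV[R]_m => v *m A).
Proof.
move=> v; have H : Ck_at 0 (fun w : 'rV[R]_m => w *m A) v.
  by apply: Ck_at_mulmx; [exact: Ck_at_id|exact: Ck_at_cst].
exact: (nbhs_singleton H).
Qed.

Lemma mulmxr_bound (R : realType) (m n : nat) (A : 'M[R]_(m, n)) :
  exists2 c : R, 0 < c & forall v : 'rV[R]_m, `|v *m A| <= c * `|v|.
Proof.
have [c c0 H] := @linear_lipschitz R _ _ (mulmxr A : {linear 'rV[R]_m -> 'rV[R]_n})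
  (@mulmxr_continuous _ _ _ A).
by exists c => // v; exact: (H v).
Qed.

Lemma unitmx_near (R : realType) (m n : nat) (A : 'rV[R]_m -> 'M[R]_n) u :
  Ck_at 0 A u -> A u \in unitmx -> \forall v \near u, A v \in unitmx.
Proof.
move=> /Ck_at_det/nbhs_singleton c Au.
have det0 : \det (A u) != 0 by rewrite -unitfE -unitmxE.
have nu : \forall v \near u, \det (A v) != 0.
  exact: (@cvgr_neq0 _ _ _ (nbhs u) _ (fun v => \det (A v)) _ c det0).
by apply: filterS nu => v; rewrite unitmxE unitfE.
Qed.

(** The error of [K] at first order solves a linear equation whose right-hand
    side is the sum of the errors of [F] and [r], the former being measured
    against [K y - K z] and hence, by the Lipschitz bound, against [y - z]. *)
Lemma diff_implicit (R : realType) (m n : nat) (F : 'rV[R]_n -> 'rV[R]_n)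
    (K r : 'rV[R]_m -> 'rV[R]_n) (z : 'rV[R]_m) (C : R) :
  differentiable F (K z) -> jacobian F (K z) \in unitmx -> differentiable r z ->
  (\forall y \near z, F (K y) = r y) -> 0 < C ->
  (\forall y \near z, `|K y - K z| <= C * `|y - z|) ->
  differentiable K z /\
  forall x, 'D_x K z = 'D_x r z *m invmx (jacobian F (K z)).
Proof.
move=> dF Mu dr FK C0 KC; set M := jacobian F (K z).
have [c c0 Hc] := mulmxr_bound (invmx M).
pose L : {linear 'rV[R]_m -> 'rV[R]_n} := mulmxr (invmx M) \o 'd r z.
have cL : continuous L.
  move=> v; apply: (@continuous_comp _ _ _ ('d r z) (fun w => w *m invmx M)).
    exact: diff_continuous.
  exact: mulmxr_continuous.
suff [dK DK] : differentiable K z /\ 'd K z = L :> (_ -> _).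
  by split=> // x; rewrite [LHS]deriveE // DK /= -deriveE.
apply: differentiable_approxP => // e e0.
(* The two errors contribute [c * e1 * C] and [c * e2], that is [e / 2] each. *)
pose e1 := e / (2 * c * C); pose e2 := e / (2 * c).
have e10 : 0 < e1 by rewrite divr_gt0 // !mulr_gt0.
have e20 : 0 < e2 by rewrite divr_gt0 // !mulr_gt0.
have /nbhs_ballP[d /= d0 Hd] := differentiable_approx dF e10.
have H1 := differentiable_approx dr e20.
have /near0_shift H2 := FK.
have /near0_shift H3 := KC.
have H4 : \forall h \near (0 : 'rV[R]_m), C * `|h| < d.
  apply/nbhs_ballP; exists (d / C); first exact: divr_gt0.
  by move=> h; rewrite -ball_normE /= sub0r normrN ltr_pdivlMr // mulrC.
apply: filterS2 (filterI H1 H2) (filterI H3 H4) => h [h1 h2] [h3 h4].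
rewrite addrK in h3.
set k := K (h + z) - K z in h3 *.
have kd : ball 0 d k.
  by rewrite -ball_normE /= sub0r normrN; exact: le_lt_trans h4.
have {}Hd := Hd _ kd.
have Ek : k - L h = (k *m M - 'd r z h) *m invmx M.
  by rewrite mulmxBl mulmxK.
rewrite Ek; apply: (le_trans (Hc _)).
have kM : 'd F (K z) k = k *m M by rewrite /M /jacobian mul_rV_lin1.
have FKz := nbhs_singleton FK.
rewrite kM /= subrK h2 FKz in Hd.
have T : `|k *m M - 'd r z h| <= e1 * `|k| + e2 * `|h|.
  have -> : k *m M - 'd r z h =
      (r (h + z) - r z - 'd r z h) - (r (h + z) - r z - k *m M).
    by rewrite [in RHS]opprB [in RHS]addrC addrA subrK.
  apply: (le_trans (ler_normB _ _)); rewrite addrC; exact: lerD.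
have -> : e * `|h| = c * (e1 * (C * `|h|) + e2 * `|h|).
  by rewrite /e1 /e2; field; rewrite !gt_eqF.
rewrite ler_pM2l //; apply: (le_trans T); rewrite lerD2r.
by rewrite ler_pM2l.
Qed.

Lemma differentiable_lipschitz_at (R : realType) (V W : normedModType R)
    (g : V -> W) (x : V) : differentiable g x ->
  exists2 C : R, 0 < C & \forall y \near x, `|g y - g x| <= C * `|y - x|.
Proof.
move=> dg; have [c c0 Hc] := linear_lipschitz (diff_continuous dg).
exists (1 + c); first exact: addr_gt0.
apply/near0_shift; apply: filterS (differentiable_approx dg ltr01) => h.
rewrite addrK mulrDl => H; rewrite -[g _ - _](subrK ('d g x h)).
by apply: le_trans (ler_normD _ _) _; exact: lerD.
Qed.

(** Differentiating [F (K y) = r y] gives [K' = r' F'(K)^-1], whose right-hand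
    side is as smooth as [K] itself: regularity is gained one order at a time. *)
Lemma Ck_at_implicit (R : realType) (m n k : nat) (F : 'rV[R]_n -> 'rV[R]_n)
    (K r : 'rV[R]_m -> 'rV[R]_n) (z : 'rV[R]_m) (d C : R) :
  Ck_at k F (K z) -> Ck_at k r z -> jacobian F (K z) \in unitmx ->
  (\forall y \near z, F (K y) = r y) -> (\forall y \near z, {for y,
    continuous K}) ->
  0 < d -> 0 < C ->
  (forall x y, `|x - K z| <= d -> `|y - K z| <= d ->
    `|x - y| <= C * `|F x - F y|) ->
  Ck_at k K z.
Proof.
move=> CF Cr Mu FK cK d0 C0 expand.
have cKz : K y @[y --> z] --> K z by exact: (nbhs_singleton cK).
have Kd : \forall y \near z, `|K y - K z| <= d := cKz _ (near_closed_ball (K z) d0).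
have KC : \forall y \near z, \forall x \near y, `|K x - K y| <= C * `|r x - r y|.
  have H : \forall y \near z, `|K y - K z| <= d /\ F (K y) = r y by exact: filterI.
  apply: filterS2 H (near_join H) => y [Ky <-]; apply: filterS => x [Kx <-].
  exact: expand.
elim: k CF Cr => [//|k IH] CF Cr.
have CK := IH (Ck_at_le (leqnSn k) CF) (Ck_at_le (leqnSn k) Cr).
have Cj := Ck_at_jacobian CF.
have nM : \forall y \near z, jacobian F (K y) \in unitmx :=
  cKz _ (unitmx_near (Ck_at_le (leq0n k) Cj) Mu).
have [dF0 _] := CF.
have dF : \forall y \near z, differentiable F (K y) := cKz _ dF0.
have [dr pr] := Cr.
have H : \forall y \near z, differentiable K y /\
  forall x, 'D_x K y = 'D_x r y *m invmx (jacobian F (K y)).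
  apply: filterS2 (filterI (filterI dF nM) dr) (filterI (near_join FK) KC).
  move=> y [[dFy My] dry] [FKy KCy].
  have [C1 C10 rC] := differentiable_lipschitz_at dry.
  apply: (@diff_implicit _ _ _ F K r y (C * C1)) => //; first exact: mulr_gt0.
  apply: filterS2 KCy rC => x Kx rx; apply: (le_trans Kx).
  by rewrite -mulrA ler_pM2l.
split; first by apply: filterS H => y [].
move=> i; have Hi : Ck_at k (fun y => 'D_(delta_mx 0 i) r y *m invmx (jacobian F
  (K y))) z.
  apply: Ck_at_mulmx; first exact: pr.
  by apply: Ck_at_invmx => //; exact: (@Ck_at_comp _ _ _ _ _ _ (jacobian F) K).
by apply: Ck_at_near_eq Hi; apply: filterS H => y [_ ->].
Qed.

(** * The pseudo-Euclidean product *)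

Section pseudo_euclidean.
Context (R : realType) (p q : nat).
Local Notation E := 'rV[R]_(p.+1 + q.+1).
Implicit Types x y z v w : E.

Definition sign_mx (a b : nat) : 'M[R]_(a + b) :=
  block_mx (1%:M : 'M[R]_a) 0 0 (- 1%:M : 'M[R]_b).

Lemma sign_mx_tr a b : (sign_mx a b)^T = sign_mx a b.
Proof. by rewrite /sign_mx tr_block_mx !trmx0 linearN /= !trmx1. Qed.

Lemma sign_mxK a b : sign_mx a b *m sign_mx a b = 1%:M.
Proof.
rewrite /sign_mx mulmx_block !mulmx0 !mul0mx !addr0 !add0r mulmx1.
by rewrite mulNmx mulmxN opprK mulmx1 -scalar_mx_block.
Qed.

Lemma sign_mx_unit a b : sign_mx a b \in unitmx.
Proof. by have /mulmx1_unit[] := sign_mxK a b. Qed.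

Local Notation J := (sign_mx p.+1 q.+1).

Lemma conj_vecE x : conj_vec x = x *m J.
Proof.
by rewrite -[x in RHS]hsubmxK mul_row_block !mulmx0 addr0 add0r mulmx1 mulmxN
  mulmx1.
Qed.

Lemma mxE00 (A B : 'M[R]_1) : A 0 0 = B 0 0 -> A = B.
Proof. by move=> H; apply/matrixP => i j; rewrite !ord1. Qed.

Lemma minkE x y : mink x y = (x *m J *m y^T) 0 0.
Proof.
rewrite -conj_vecE /conj_vec -[y in RHS]hsubmxK tr_row_mx mul_row_col mulNmx.
by rewrite [RHS]mxE [X in _ + X]mxE /mink /dot.
Qed.

Lemma minkC x y : mink x y = mink y x.
Proof.
rewrite !minkE; have -> : y *m J *m x^T = (x *m J *m y^T)^T.
  by rewrite !trmx_mul trmxK sign_mx_tr mulmxA.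
by rewrite [RHS]mxE.
Qed.

Lemma minkDl x y z : mink (x + y) z = mink x z + mink y z.
Proof. by rewrite !minkE !mulmxDl mxE. Qed.
Lemma minkZl a x z : mink (a *: x) z = a * mink x z.
Proof. by rewrite !minkE -!scalemxAl mxE. Qed.
Lemma minkNl x z : mink (- x) z = - mink x z.
Proof. by rewrite -scaleN1r minkZl mulN1r. Qed.
Lemma minkDr x y z : mink z (x + y) = mink z x + mink z y.
Proof. by rewrite minkC minkDl !(minkC z). Qed.
Lemma minkZr a x z : mink z (a *: x) = a * mink z x.
Proof. by rewrite minkC minkZl (minkC z). Qed.
Lemma minkNr x z : mink z (- x) = - mink z x.
Proof. by rewrite minkC minkNl (minkC z). Qed.
Lemma mink0l z : mink 0 z = 0.
Proof. by rewrite -(scale0r 0) minkZl mul0r. Qed.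
Lemma mink_suml (I : Type) (r : seq I) (F : I -> E) z :
  mink (\sum_(i <- r) F i) z = \sum_(i <- r) mink (F i) z.
Proof.
elim: r => [|i r IH]; first by rewrite !big_nil mink0l.
by rewrite !big_cons minkDl IH.
Qed.
Lemma conj_vecK x : conj_vec (conj_vec x) = x.
Proof. by rewrite !conj_vecE -mulmxA sign_mxK mulmx1. Qed.
Lemma conj_vecD x y : conj_vec (x + y) = conj_vec x + conj_vec y.
Proof. by rewrite !conj_vecE mulmxDl. Qed.
Lemma conj_vecZ a x : conj_vec (a *: x) = a *: conj_vec x.
Proof. by rewrite !conj_vecE scalemxAl. Qed.
Lemma mink_conj x y : mink (conj_vec x) (conj_vec y) = mink x y.
Proof.
by rewrite !minkE !conj_vecE trmx_mul sign_mx_tr -mulmxA [J *m (_ *m _)]mulmxA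
  sign_mxK mul1mx.
Qed.
Lemma mink_conjl x y : mink (conj_vec x) y = mink x (conj_vec y).
Proof. by rewrite -mink_conj conj_vecK. Qed.
Lemma mink_conjr x y : mink x (conj_vec y) = dot x y.
Proof.
by rewrite -mink_conjl minkE conj_vecE -[x *m J *m J]mulmxA sign_mxK mulmx1.
Qed.

Lemma mink_rows (a b : nat) (A : 'M[R]_(a, _)) (B : 'M[R]_(b, _)) i j :
  (A *m J *m B^T) i j = mink (row i A) (row j B).
Proof.
rewrite minkE -row_mul tr_row [LHS]mxE [RHS]mxE; apply: eq_bigr => k _.
by rewrite [row _ _ _ _]mxE [col _ _ _ _]mxE.
Qed.

Lemma mink_nondeg x : (forall z, mink x z = 0) -> x = 0.
Proof.
move=> H; apply/rowP => i; have := H (conj_vec (delta_mx 0 i)).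
rewrite mink_conjr /dot trmx_delta -colE !mxE; exact.
Qed.

Lemma lsub_conj x : lsubmx (conj_vec x) = lsubmx x.
Proof. by rewrite row_mxKl. Qed.
Lemma rsub_conj x : rsubmx (conj_vec x) = - rsubmx x.
Proof. by rewrite row_mxKr. Qed.

Lemma dot_split x y : dot x y = dot (lsubmx x) (lsubmx y) + dot (rsubmx x)
  (rsubmx y).
Proof.
rewrite -mink_conjr /mink lsub_conj rsub_conj /dot linearN /= mulmxN.
by rewrite [X in _ - X]mxE opprK.
Qed.

Lemma sphereP y : sphere_prod R p q y <-> mink y y = 0 /\ mink y (conj_vec y) = 2.
Proof.
rewrite mink_conjr dot_split /mink /sphere_prod /=.
set a := dot _ _; set b := dot _ _; split=> -[h1 h2]; first by rewrite h1 h2;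
  split; lra.
by split; lra.
Qed.

Lemma tprojE y v : tproj y v =
  v - (mink v (conj_vec y) / 2) *: y - (mink v y / 2) *: conj_vec y.
Proof.
rewrite mink_conjr dot_split /mink; set a := dot _ _; set b := dot _ _.
rewrite /tproj -/a -/b -[in RHS](hsubmxK v) -[in RHS](hsubmxK y).
rewrite conj_vecE mul_row_block !mulmx0 addr0 add0r mulmx1 mulmxN mulmx1.
rewrite !scale_row_mx !opp_row_mx !add_row_mx; congr row_mx.
  by apply/rowP => i; rewrite !mxE; field.
by apply/rowP => i; rewrite !mxE; field.
Qed.

(** The vectors [y] and [conj_vec y] span the normal space of S^p x S^q at [y]. *)
Definition tangent y v := mink v y = 0 /\ mink v (conj_vec y) = 0.

Lemma tproj_id y v : tangent y v -> tproj y v = v.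
Proof. by case=> h1 h2; rewrite tprojE h1 h2 !mul0r !scale0r !subr0. Qed.

Lemma tprojD y v w : tproj y (v + w) = tproj y v + tproj y w.
Proof.
rewrite !tprojE !minkDl; set a := mink _ _; set b := mink _ _; set c := mink _ _.
by set d := mink _ _; apply/rowP => i; rewrite !mxE; field.
Qed.

Lemma tprojZ y a v : tproj y (a *: v) = a *: tproj y v.
Proof.
rewrite !tprojE !minkZl; set b := mink _ _; set c := mink _ _.
by apply/rowP => i; rewrite !mxE; field.
Qed.

Lemma tproj_sym y v w : mink (tproj y v) w = mink v (tproj y w).
Proof.
rewrite !tprojE !(minkDl,minkDr,minkNl,minkNr,minkZl,minkZr).
rewrite (minkC y w) (minkC (conj_vec y) w); ring.
Qed.

Lemma tangent_conj y v : tangent y v -> tangent y (conj_vec v).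
Proof. by case=> h1 h2; split; rewrite ?mink_conj // mink_conjl. Qed.

Lemma tangentD y v w : tangent y v -> tangent y w -> tangent y (v + w).
Proof. by move=> [h1 h2] [h3 h4]; split; rewrite minkDl ?h1 ?h2 ?h3 ?h4 addr0. Qed.

Lemma tangentZ y a v : tangent y v -> tangent y (a *: v).
Proof. by move=> [h1 h2]; split; rewrite minkZl ?h1 ?h2 mulr0. Qed.

Section at_point.
Context (y : E) (Sy : sphere_prod R p q y).

Lemma tproj_tangent v : tangent y (tproj y v).
Proof.
have [h1 h2] := (sphereP y).1 Sy.
rewrite /tangent tprojE !(minkDl,minkNl,minkZl) mink_conj (minkC (conj_vec y)) h1
  h2.
by split; field.
Qed.

Lemma tproj_normal : tproj y y = 0 /\ tproj y (conj_vec y) = 0.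
Proof.
have [h1 h2] := (sphereP y).1 Sy.
rewrite !tprojE mink_conj (minkC (conj_vec y)) h1 h2 mul0r scale0r.
by rewrite divff // !scale1r scale0r !subr0 !subrr.
Qed.

End at_point.

End pseudo_euclidean.
Arguments sign_mx {R} a b.
Arguments tangent {R p q} y v.

(** * Frames of the tangent spaces *)

Section orthonormal_completion.
Context (R : realType) (m : nat).
Implicit Types y v : 'rV[R]_(1 + m).

Lemma dot_mx y v : y *m v^T = (dot y v)%:M.
Proof. by apply: mxE00; rewrite [RHS]mxE mulr1n. Qed.

Lemma dotC y v : dot y v = dot v y.
Proof.
rewrite /dot; have -> : y *m v^T = (v *m y^T)^T by rewrite trmx_mul trmxK.
by rewrite [LHS]mxE.
Qed.

Lemma dot_eq0 y : dot y y = 0 -> y = 0.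
Proof.
rewrite /dot mxE => /eqP; rewrite psumr_eq0 => [/allP H|i _]; last first.
  by rewrite mxE -expr2 sqr_ge0.
apply/rowP => i; rewrite mxE; have := H i (mem_index_enum i).
by rewrite mxE -expr2 sqrf_eq0 => /eqP.
Qed.

(** Orthogonality of a matrix with first row [y] splits into these statements
    about the remaining rows; such a matrix is the Householder reflection
    exchanging [y] and the first basis vector. *)
Lemma unit_vector_frame y : dot y y = 1 ->
  exists O : 'M[R]_(m, 1 + m), [/\ O *m O^T = 1%:M, O *m y^T = 0 &
    O^T *m O = 1%:M - y^T *m y].
Proof.
move=> y1.
suff [H [HH Hy]] : exists H : 'M[R]_(1 + m), H *m H^T = 1%:M /\ usubmx H = y.
  have E : H = col_mx y (dsubmx H) by rewrite -Hy vsubmxK.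
  exists (dsubmx H).
  have H2 := mulmx1C HH.
  move: HH; rewrite E tr_col_mx mul_col_row scalar_mx_block col_mxKd.
  move=> /eq_block_mx[_ _ -> ->]; split=> //.
  move: H2; rewrite E tr_col_mx mul_row_col ?col_mxKd -scalar_mx_block => <-.
  by rewrite [RHS]addrAC subrr add0r.
pose e : 'rV[R]_(1 + m) := row_mx 1%:M 0.
have e1 : dot e e = 1.
  by rewrite /dot /e tr_row_mx mul_row_col mul0mx addr0 trmx1 mulmx1 mxE.
have eH (H : 'M[R]_(1 + m)) : usubmx H = e *m H.
  by rewrite -[H in RHS]vsubmxK /e mul_row_col mul1mx mul0mx addr0.
have [ye|ye] := eqVneq y e.
  by exists 1%:M; rewrite eH trmx1 !mulmx1.
have [v vE] : exists v, v = y - e by exists (y - e).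
pose c := dot v v.
have c0 : c != 0.
  by apply: contra ye => /eqP /dot_eq0 /eqP; rewrite vE subr_eq0.
pose H : 'M[R]_(1 + m) := 1%:M - (2 / c) *: (v^T *m v).
have HT : H^T = H by rewrite /H linearB /= trmx1 linearZ /= trmx_mul trmxK.
have cE : c = 2 - 2 * dot e y.
  have bl (a b : 'rV[R]_(1 + m)) : dot (a - b) (a - b) = dot a a - 2 * dot b a +
    dot b b.
    have -> : dot (a - b) (a - b) = dot a a - dot a b - (dot b a - dot b b).
      rewrite /dot linearB /= mulmxBl !mulmxBr !mxE; ring.
    rewrite (dotC a b); ring.
  rewrite /c vE bl y1 e1; ring.
exists H; split.
  rewrite HT /H mulmxBl mul1mx mulmxBr mulmx1 -scalemxAl -scalemxAr.
  rewrite -mulmxA [v *m (_ *m _)]mulmxA dot_mx mul_scalar_mx -/c -scalemxAr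
    !scalerA.
  have -> : 2 / c * (2 / c * c) = 2 / c + 2 / c by field.
  have SS (S : 'M[R]_(1 + m)) : S - (S + S) = - S by rewrite opprD addrA subrr
    sub0r.
  by rewrite scalerDl SS opprK subrK.
rewrite eH /H mulmxBr mulmx1 -scalemxAr mulmxA dot_mx mul_scalar_mx scalerA.
have -> : dot e v = - (c / 2).
  have -> : dot e v = dot e y - dot e e by rewrite /dot vE linearB /= mulmxBr !mxE.
  by rewrite e1 cE; field.
have -> : 2 / c * - (c / 2) = -1 by field.
by rewrite scaleN1r opprK vE addrC subrK.
Qed.

End orthonormal_completion.

Section frames.
Context (R : realType) (p q : nat).
Local Notation E := 'rV[R]_(p.+1 + q.+1).
Local Notation J := (sign_mx p.+1 q.+1).
Local Notation D := (sign_mx p q).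
Context (y : E) (Sy : sphere_prod R p q y).

Definition orthonormal_frame (B : 'M[R]_(p + q, p.+1 + q.+1)) :=
  [/\ forall i, tangent y (row i B), B *m J *m B^T = D &
      forall v, v *m (J *m B^T *m D) *m B = tproj y v].

Lemma orthonormal_frame_exists : exists B, orthonormal_frame B.
Proof.
have [y1 y2] := Sy.
have [H1 [HH1 Hy1 Hp1]] := @unit_vector_frame R p _ y1.
have [H2 [HH2 Hy2 Hp2]] := @unit_vector_frame R q _ y2.
exists (block_mx H1 0 0 H2).
have By : block_mx H1 0 0 H2 *m y^T = 0.
  rewrite -[y]hsubmxK tr_row_mx mul_block_col Hy1 Hy2 !mul0mx addr0 add0r.
  by rewrite col_mx0.
have BJ : block_mx H1 0 0 H2 *m J = block_mx H1 0 0 (- H2).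
  by rewrite mulmx_block !mulmx0 !mul0mx !addr0 !add0r mulmx1 mulmxN mulmx1.
have BJy : block_mx H1 0 0 H2 *m J *m y^T = 0.
  rewrite BJ -[y]hsubmxK tr_row_mx mul_block_col mulNmx Hy1 Hy2 !mul0mx addr0 oppr0.
  by rewrite add0r col_mx0.
split=> [i||v].
- split; rewrite minkE ?conj_vecE ?trmx_mul ?sign_mx_tr -!row_mul ?BJy.
    by rewrite !mxE.
  by rewrite -[_ *m J *m _]mulmxA [J *m (J *m _)]mulmxA sign_mxK mul1mx By !mxE.
- rewrite BJ tr_block_mx !trmx0 mulmx_block !mulmx0 !mul0mx !addr0 add0r mulNmx.
  by rewrite HH1 HH2.
rewrite tr_block_mx !trmx0 !mulmx_block !mulmx0 !mul0mx !addr0 !add0r.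
rewrite !mulNmx !mul1mx !mulmxN !mulmx1 opprK -[v]hsubmxK !mul_row_block.
rewrite ?oppr0 ?mulmx0 ?mul0mx ?addr0 ?add0r -!mulmxA Hp1 Hp2 !mulmxBr !mulmx1.
by rewrite ![_ *m (_ *m _)]mulmxA !dot_mx !mul_scalar_mx /tproj row_mxKl row_mxKr.
Qed.

Context (B : 'M[R]_(p + q, p.+1 + q.+1)) (FB : orthonormal_frame B).

(** Coordinates in the frame are obtained by pairing with its vectors. *)
Lemma frameK : B *m (J *m B^T *m D) = 1%:M.
Proof. by have [_ H _] := FB; rewrite !mulmxA H sign_mxK. Qed.

Lemma frame_decomp v : tangent y v -> v *m (J *m B^T *m D) *m B = v.
Proof. by have [_ _ ->] := FB; exact: tproj_id. Qed.

Lemma frame_decomp_mx n (C : 'M[R]_(n, _)) :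
  (forall i, tangent y (row i C)) -> C *m (J *m B^T *m D) *m B = C.
Proof. by move=> H; apply/row_matrixP => i; rewrite !row_mul frame_decomp. Qed.

Lemma frame_change (C : 'M[R]_(p + q, p.+1 + q.+1)) :
  (forall i, tangent y (row i C)) -> \rank C = (p + q)%N ->
  exists2 P : 'M[R]_(p + q), P \in unitmx & C = P *m B.
Proof.
move=> tC rC; exists (C *m (J *m B^T *m D)); last by rewrite frame_decomp_mx.
rewrite -row_free_unit -row_leq_rank -{1}rC -{1}(frame_decomp_mx tC).
exact: mxrankM_maxl.
Qed.

Lemma mul_tangent_mx v : v *m tangent_mx y = tproj y v.
Proof.
by apply: mul_lin1_mx => [x z|a x]; [exact: tprojD|exact: tprojZ].
Qed.

End frames.

Section endomorphisms.
Context (R : realType) (p q : nat).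
Local Notation E := 'rV[R]_(p.+1 + q.+1).
Local Notation J := (sign_mx p.+1 q.+1).
Context (y : E) (Sy : sphere_prod R p q y).

(** The bases [row_base _] and [C] have sizes [\rank (tangent_mx y)] and
    [p + q], which are equal but not convertible; the transition matrices [Q]
    and [P2] are therefore rectangular. *)
Lemma endo_basis_change (A : 'M[R]_(p.+1 + q.+1)) (C : 'M[R]_(p + q, p.+1 + q.+1)) :
  (forall i, tangent y (row i C)) -> \rank C = (p + q)%N ->
  (forall v, tangent y v -> tangent y (v *m A)) ->
  let A0 := conjmx (row_base (tangent_mx y)) A in
  exists A' : 'M[R]_(p + q), [/\ C *m A = A' *m C,
    (A' \in unitmx) = (A0 \in unitmx) &
    A0 \in unitmx -> \tr (invmx A') = \tr (invmx A0)].
Proof.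
move=> tC rC tA; set V := row_base _; set A0 := conjmx V A => /=.
have [B FB] := orthonormal_frame_exists Sy.
have tV i : tangent y (row i V).
  have : (row i V <= tangent_mx y)%MS by rewrite (submx_trans (row_sub _ _)) //
    eq_row_base.
  by move=> /submxP[w ->]; rewrite mul_tangent_mx; exact: tproj_tangent.
have [P uP CP] := frame_change FB tC rC.
have inV n (M : 'M[R]_(n, _)) : (forall i, tangent y (row i M)) -> (M <= V)%MS.
  move=> tM; apply/row_subP => i; rewrite eq_row_base.
  by rewrite -(tproj_id (tM i)) -mul_tangent_mx submxMl.
have [Q VQ] : exists Q, V = Q *m C.
  exists (V *m (J *m B^T *m sign_mx p q) *m invmx P).
  by rewrite CP mulmxA mulmxKV // (frame_decomp_mx FB).
have [P2 CP2] := submxP (inV _ _ tC).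
have P2Q : P2 *m Q = 1%:M.
  have fC : row_free C by rewrite /row_free rC.
  by apply: (row_free_inj fC); rewrite mul1mx -mulmxA -VQ.
have QP2 : Q *m P2 = 1%:M.
  by apply: (row_free_inj (row_base_free (tangent_mx y)));
    rewrite mul1mx -mulmxA -CP2.
have A0V : A0 *m V = V *m A.
  by rewrite /A0 /conjmx mulmxKpV // inV // => i; rewrite row_mul; exact: tA.
clearbody A0; clearbody V.
have A0E : A0 = Q *m (P2 *m A0 *m Q) *m P2.
  by rewrite !mulmxA QP2 mul1mx -mulmxA QP2 mulmx1.
have inv1 : A0 \in unitmx -> (P2 *m A0 *m Q) *m (P2 *m invmx A0 *m Q) = 1%:M.
  move=> u0; rewrite -!mulmxA [Q *m (P2 *m _)]mulmxA QP2 mul1mx.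
  by rewrite [A0 *m (_ *m _)]mulmxA mulmxV // mul1mx.
exists (P2 *m A0 *m Q); split.
- by rewrite {1}CP2 -!mulmxA -VQ A0V.
- apply/idP/idP => [u1|/inv1 /mulmx1_unit[]//].
  have : A0 *m (Q *m invmx (P2 *m A0 *m Q) *m P2) = 1%:M.
    rewrite {1}A0E; set A' := P2 *m A0 *m Q in u1 *; clearbody A'.
    by rewrite -!mulmxA [P2 *m (Q *m _)]mulmxA P2Q mul1mx [A' *m (_ *m _)]mulmxA
      mulmxV // mul1mx.
  by case/mulmx1_unit.
- move=> u0; have i1 := inv1 u0.
  have [u1 _] := mulmx1_unit i1.
  have -> : invmx (P2 *m A0 *m Q) = P2 *m invmx A0 *m Q.
    by rewrite -[LHS]mulmx1 -i1 mulKmx.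
  by rewrite mxtrace_mulC mulmxA QP2 mul1mx.
Qed.

End endomorphisms.

(** * Derivatives of the algebraic operations *)

Section derivatives.
Context (R : realType) (V : normedModType R).
Implicit Types (u x : V).

Lemma derive_mulmx (a b c : nat) (A : V -> 'M[R]_(a, b))
  (B : V -> 'M[R]_(b, c)) u x :
  differentiable A u -> differentiable B u ->
  differentiable (fun v => A v *m B v) u /\
  'D_x (fun v => A v *m B v) u = 'D_x A u *m B u + A u *m 'D_x B u.
Proof.
move=> dA dB.
have dAc i j : differentiable (fun v => A v i j) u by move/differentiable_mxP: dA.
have dBc i j : differentiable (fun v => B v i j) u by move/differentiable_mxP: dB.
have E i j : (fun v => (A v *m B v) i j) =
    \sum_k ((fun v => A v i k) * (fun v => B v k j)).
  by apply/funext => v; rewrite mxE fct_sumE.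
have dM i j k : differentiable ((fun v => A v i k) * (fun v => B v k j)) u.
  exact: differentiableM.
have d : differentiable (fun v => A v *m B v) u.
  by apply/differentiable_mxP => i j; rewrite E; exact: differentiable_sum.
split=> //; apply/matrixP => i j; rewrite (derive_coord _ _ _ d) E derive_sum;
  last first.
  by move=> k; exact: diff_derivable.
rewrite !mxE -big_split /=; apply: eq_bigr => k _.
rewrite deriveM; [|exact: diff_derivable|exact: diff_derivable].
by rewrite (derive_coord _ _ _ dA) (derive_coord _ _ _ dB) [LHS]addrC
  /GRing.scale /= [B u k j * _]mulrC.
Qed.

Lemma derive_mulmxr (a b c : nat) (A : V -> 'M[R]_(a, b)) (B : 'M[R]_(b, c)) u x :
  differentiable A u ->
  differentiable (fun v => A v *m B) u /\
  'D_x (fun v => A v *m B) u = 'D_x A u *m B.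
Proof.
move=> dA; have [d ->] := derive_mulmx x dA (differentiable_cst B u).
by rewrite derive_cst mulmx0 addr0.
Qed.

Lemma derive_trmx (a b : nat) (A : V -> 'M[R]_(a, b)) u x :
  differentiable A u ->
  differentiable (fun v => (A v)^T) u /\ 'D_x (fun v => (A v)^T) u = ('D_x A u)^T.
Proof.
move=> dA; have dAc i j : differentiable (fun v => A v i j) u by
  move/differentiable_mxP: dA.
have E i j : (fun v => (A v)^T i j) = (fun v => A v j i).
  by apply/funext => v; rewrite mxE.
have d : differentiable (fun v => (A v)^T) u.
  by apply/differentiable_mxP => i j; rewrite E.
split=> //; apply/matrixP => i j.
by rewrite (derive_coord _ _ _ d) E mxE (derive_coord _ _ _ dA).
Qed.

Lemma derive_scale (a b : nat) (f : V -> R) (A : V -> 'M[R]_(a, b)) u x :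
  differentiable f u -> differentiable A u ->
  differentiable (fun v => f v *: A v) u /\
  'D_x (fun v => f v *: A v) u = 'D_x f u *: A u + f u *: 'D_x A u.
Proof.
move=> df dA.
have dAc i j : differentiable (fun v => A v i j) u by move/differentiable_mxP: dA.
have E i j : (fun v => (f v *: A v) i j) = f * (fun v => A v i j).
  by apply/funext => v; rewrite mxE.
have d : differentiable (fun v => f v *: A v) u.
  by apply/differentiable_mxP => i j; rewrite E; exact: differentiableM.
split=> //; apply/matrixP => i j.
rewrite (derive_coord _ _ _ d) E deriveM;
  [|exact: diff_derivable|exact: diff_derivable].
by rewrite !mxE (derive_coord _ _ _ dA) [LHS]addrC /GRing.scale /= [A u i j *
  _]mulrC.
Qed.

Lemma derive_add (W : normedModType R) (F G : V -> W) u x :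
  differentiable F u -> differentiable G u ->
  differentiable (fun v => F v + G v) u /\
  'D_x (fun v => F v + G v) u = 'D_x F u + 'D_x G u.
Proof.
move=> dF dG; split; first exact: differentiableD.
by apply: deriveD; exact: diff_derivable.
Qed.

Lemma derive_mul (f g : V -> R) u x :
  differentiable f u -> differentiable g u ->
  differentiable (fun v => f v * g v) u /\
  'D_x (fun v => f v * g v) u = 'D_x f u * g u + f u * 'D_x g u.
Proof.
move=> df dg; split; first exact: differentiableM.
rewrite deriveM; [|exact: diff_derivable|exact: diff_derivable].
by rewrite [LHS]addrC /GRing.scale /= [g u * _]mulrC.
Qed.

Context (p q : nat).
Implicit Types F G : V -> 'rV[R]_(p.+1 + q.+1).

Lemma derive_conj F u x : differentiable F u ->
  differentiable (fun v => conj_vec (F v)) u /\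
  'D_x (fun v => conj_vec (F v)) u = conj_vec ('D_x F u).
Proof.
move=> dF; have -> : (fun v => conj_vec (F v)) = (fun v => F v *m sign_mx p.+1
  q.+1).
  by apply/funext => v; exact: conj_vecE.
by rewrite conj_vecE; exact: derive_mulmxr.
Qed.

Lemma derive_mink F G u x : differentiable F u -> differentiable G u ->
  differentiable (fun v => mink (F v) (G v)) u /\
  'D_x (fun v => mink (F v) (G v)) u = mink ('D_x F u) (G u) + mink (F u) ('D_x G
    u).
Proof.
move=> dF dG; pose J : 'M[R]_(p.+1 + q.+1) := sign_mx p.+1 q.+1.
have -> : (fun v => mink (F v) (G v)) = (fun v => (F v *m J *m (G v)^T) 0 0).
  by apply/funext => v; exact: minkE.
have [d1 D1] := derive_mulmxr J x dF.
have [d2 D2] := derive_trmx x dG.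
have [d D] := derive_mulmx x d1 d2.
split; first by move/differentiable_mxP: d.
by rewrite -(derive_coord _ _ _ d) D D1 D2 mxE !minkE.
Qed.

End derivatives.

Section smooth_operations.
Context (R : realType) (m p q k : nat).
Implicit Types F G : 'rV[R]_m -> 'rV[R]_(p.+1 + q.+1).

Lemma Ck_at_conj F u : Ck_at k F u -> Ck_at k (fun v => conj_vec (F v)) u.
Proof.
move=> H; have H' := Ck_at_mulmx H (Ck_at_cst k (sign_mx p.+1 q.+1) u).
by apply: Ck_at_near_eq H'; apply: near_always => v; rewrite conj_vecE.
Qed.

Lemma Ck_at_mink F G u : Ck_at k F u -> Ck_at k G u -> Ck_at k
  (fun v => mink (F v) (G v)) u.
Proof.
move=> HF HG.
have H := Ck_at_mulmx (Ck_at_mulmx HF (Ck_at_cst k (sign_mx p.+1 q.+1) u))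
  (Ck_at_trmx HG).
move/Ck_at_mxP : H => /(_ 0 0).
by apply: Ck_at_near_eq; apply: near_always => v; rewrite minkE.
Qed.

End smooth_operations.

(** * The retraction onto S^p x S^q *)

Section retraction.
Context (R : realType) (p q : nat).
Local Notation E := 'rV[R]_(p.+1 + q.+1).
Implicit Types y z x : E.

(** The half-sums [(z + conj_vec z) / 2] and [(z - conj_vec z) / 2] are the two
    components of [z]. This expression of their squared lengths and of their
    normalization goes through [mink] and [conj_vec] only, whose derivatives
    are known. *)
Definition sqr_len1 z := 2^-1 * mink z (z + conj_vec z).
Definition sqr_len2 z := 2^-1 * mink z (conj_vec z + -1 *: z).
Definition retract z : E :=
  (2^-1 * (Num.sqrt (sqr_len1 z))^-1) *: (z + conj_vec z) +
  (2^-1 * (Num.sqrt (sqr_len2 z))^-1) *: (z + -1 *: conj_vec z).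

Lemma sphere_len y : sphere_prod R p q y <-> sqr_len1 y = 1 /\ sqr_len2 y = 1.
Proof.
rewrite sphereP /sqr_len1 /sqr_len2 !minkDr !minkZr.
by set a := mink _ _; set b := mink _ _; split=> -[h1 h2]; split; lra.
Qed.

Lemma retract_id y : sphere_prod R p q y -> retract y = y.
Proof.
move=> /sphere_len[h1 h2]; rewrite /retract h1 h2 sqrtr1 invr1 mulr1.
by apply/rowP => i; rewrite !mxE; field.
Qed.

Lemma retract_sphere z : 0 < sqr_len1 z -> 0 < sqr_len2 z -> sphere_prod R p q
  (retract z).
Proof.
move=> h1 h2.
have s1 := sqr_sqrtr (ltW h1); have s2 := sqr_sqrtr (ltW h2).
have n1 : Num.sqrt (sqr_len1 z) != 0 by rewrite gt_eqF // sqrtr_gt0.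
have n2 : Num.sqrt (sqr_len2 z) != 0 by rewrite gt_eqF // sqrtr_gt0.
rewrite /retract; set a := Num.sqrt _ in s1 n1 *; set b := Num.sqrt _ in s2 n2 *.
move: s1 s2; rewrite /sqr_len1 /sqr_len2 !minkDr !minkZr => s1 s2.
apply/sphereP.
rewrite !(conj_vecD, conj_vecZ, conj_vecK, minkDl, minkDr, minkZl, minkZr,
  mink_conj).
rewrite (minkC (conj_vec z) z).
set c := mink z z in s1 s2 *; set d := mink z (conj_vec z) in s1 s2 *.
have ->: d = a ^+ 2 + b ^+ 2 by lra.
have ->: c = a ^+ 2 - b ^+ 2 by lra.
by split; field; rewrite n1 n2.
Qed.

Lemma Ck_at_sqr_len k y : Ck_at k sqr_len1 y /\ Ck_at k sqr_len2 y.
Proof.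
have Cid := @Ck_at_id R (p.+1 + q.+1) k y.
split; (apply: Ck_at_mul; first exact: Ck_at_cst); apply: Ck_at_mink => //.
  by apply: Ck_at_add => //; exact: Ck_at_conj.
apply: Ck_at_add; first exact: Ck_at_conj.
by apply: Ck_at_scale => //; exact: Ck_at_cst.
Qed.

Lemma retract_sphere_near y : sphere_prod R p q y ->
  \forall z \near y, sphere_prod R p q (retract z).
Proof.
move=> /sphere_len[h1 h2].
have [/nbhs_singleton c1 /nbhs_singleton c2] := Ck_at_sqr_len 0 y.
have H1 : \forall z \near y, 0 < sqr_len1 z.
  by apply: (@cvgr_gt _ _ (nbhs y) _ sqr_len1 (sqr_len1 y)) => //; rewrite h1.
have H2 : \forall z \near y, 0 < sqr_len2 z.
  by apply: (@cvgr_gt _ _ (nbhs y) _ sqr_len2 (sqr_len2 y)) => //; rewrite h2.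
by apply: filterS2 H1 H2 => z; exact: retract_sphere.
Qed.

Lemma Ck_at_retract k y : sphere_prod R p q y -> Ck_at k retract y.
Proof.
move=> /sphere_len[h1 h2]; have [c1 c2] := Ck_at_sqr_len k y.
have Cid := @Ck_at_id R (p.+1 + q.+1) k y.
have Ch : Ck_at k (fun=> 2^-1 : R) y by exact: Ck_at_cst.
apply: Ck_at_add; apply: Ck_at_scale.
- apply: Ck_at_mul => //; apply: Ck_at_inv; first by rewrite h1 sqrtr1 oner_eq0.
  by apply: Ck_at_sqrt => //; rewrite h1.
- by apply: Ck_at_add => //; exact: Ck_at_conj.
- apply: Ck_at_mul => //; apply: Ck_at_inv; first by rewrite h2 sqrtr1 oner_eq0.
  by apply: Ck_at_sqrt => //; rewrite h2.
- apply: Ck_at_add => //; apply: Ck_at_scale; first exact: Ck_at_cst.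
  exact: Ck_at_conj.
Qed.

Lemma derive_retract y x : sphere_prod R p q y -> 'D_x retract y = tproj y x.
Proof.
move=> /sphere_len[h1 h2].
have [c1 c2] := Ck_at_sqr_len 1 y.
have d1 := Ck_at_diff c1; have d2 := Ck_at_diff c2.
have did : differentiable (@id E) y by [].
have [dc Dc] := derive_conj x did.
have [dn Dn] := derive_scale x (differentiable_cst (-1 : R) y) did.
have [dnc Dnc] := derive_scale x (differentiable_cst (-1 : R) y) dc.
have [dp Dp] := derive_add x did dc.
have [dm Dm] := derive_add x dc dn.
have [dm' Dm'] := derive_add x did dnc.
have [e1 E1] := derive_mink x did dp.
have [e2 E2] := derive_mink x did dm.
have dh := differentiable_cst (2^-1 : R) y.
have [_ L1] := derive_mul x dh e1.
have [_ L2] := derive_mul x dh e2.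
have inv_half (f : E -> R) : differentiable f y -> f y = 1 ->
    differentiable (fun z => 2^-1 * (Num.sqrt (f z))^-1) y /\
    'D_x (fun z => 2^-1 * (Num.sqrt (f z))^-1) y = - 4^-1 * 'D_x f y.
  move=> df f1; have f0 : 0 < f y by rewrite f1.
  have [ds Ds] := derive_sqrt_comp x df f0.
  have s0 : Num.sqrt (f y) != 0 by rewrite f1 sqrtr1 oner_eq0.
  have di := differentiableV ds s0.
  have [dd ->] := derive_mul x dh di; split=> //.
  rewrite derive_cst mul0r add0r deriveV //; last exact: diff_derivable.
  by rewrite Ds f1 sqrtr1 /GRing.scale /=; field.
have [a1 A1] := inv_half _ d1 h1.
have [a2 A2] := inv_half _ d2 h2.
have [b1 B1] := derive_scale x a1 dp.
have [b2 B2] := derive_scale x a2 dm'.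
have [_ ->] := derive_add x b1 b2.
rewrite B1 B2 A1 A2 h1 h2 sqrtr1 /sqr_len1 /sqr_len2 L1 L2 E1 E2 Dp Dm Dm' Dn Dnc
  Dc.
rewrite !derive_cst !derive_id tprojE !(minkDl, minkDr, minkZl,
  minkZr) !scale0r !add0r.
rewrite (minkC y (conj_vec x)) mink_conjl (minkC y x).
rewrite /cst; move: (mink x y) (mink x (conj_vec y)) => a b.
move: (mink y y) (mink y _) (conj_vec x) (conj_vec y) => c d x' y'.
by apply/rowP => i; rewrite !mxE; field.
Qed.

End retraction.

(** * Calculus through the covering *)

Lemma near_within (T : topologicalType) (w : T) (P : set T) :
  (\forall v \near w, P v) -> exists O, [/\ open O, O w & forall v, O v -> P v].
Proof.
move=> H; have {H} : nbhs w P by exact: H.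
by rewrite nbhsE => -[B [oB Bw] BP]; exists B.
Qed.

Section covering.
Context (R : realType) (p q : nat) (T : topologicalType).
Local Notation E := 'rV[R]_(p.+1 + q.+1).
Local Notation S := (sphere_prod R p q).
Context (pi : T -> E) (cpi : covering_map S pi).

Lemma covering_continuous : continuous pi. Proof. by have [] := cpi. Qed.

Lemma covering_sphere w : S (pi w).
Proof. by have [_ <- _] := cpi; exists w. Qed.

Lemma covering_onto y : S y -> exists w, pi w = y.
Proof. by have [_ <- _] := cpi => -[w _ <-]; exists w. Qed.

Lemma covering_chart w : exists W : set T, [/\ open W, W w, {in W &, injective pi} &
  forall O, open O -> O `<=` W -> exists2 V : set E, open V & pi @` O = V `&` S].
Proof.
have [_ _ H] := cpi; have [V [oV Vw [I [W [oW _ piW HW]]]]] :=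
  H _ (covering_sphere w).
have : (pi @^-1` V) w by [].
rewrite piW => -[i _ Wiw]; exists (W i); have [inj _ opn] := HW i; split=> //;
  exact: oW.
Qed.

Lemma covering_injective_near w : exists W : set T, [/\ open W, W w &
  forall v v', W v -> W v' -> pi v = pi v' -> v = v'].
Proof.
have [W [oW Ww inj _]] := covering_chart w; exists W; split=> // v v' Wv Wv'.
by apply: inj; rewrite inE.
Qed.

(** The lift is [r] followed by the inverse of a sheet of the covering. *)
Lemma covering_lift (r : E -> E) w :
  (forall y, S y -> r y = y) -> (\forall z \near pi w, S (r z)) ->
  (\forall z \near pi w, {for z, continuous r}) ->
  exists l : E -> T, (\forall v \near w, l (pi v) = v) /\
    \forall z \near pi w, pi (l z) = r z /\ {for z, continuous l}.
Proof.
move=> rid rS rc; have [W [oW Ww inj opn]] := covering_chart w.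
have [V oV VE] := opn _ oW (@subset_refl _ W).
have injW v v' : W v -> W v' -> pi v = pi v' -> v = v'.
  by move=> ? ?; apply: inj; rewrite inE.
pose l z := xget w [set v | W v /\ pi v = r z].
have lP z v : W v -> pi v = r z -> l z = v.
  move=> Wv piv; rewrite /l; case: xgetP => [v' _ [Wv' piv']|/(_ v)]; last by case.
  by apply: injW => //; rewrite piv'.
have ex z : V (r z) -> S (r z) -> exists2 v, W v & pi v = r z.
  by move=> Vz Sz; have : (V `&` S) (r z) by []; rewrite -VE => -[v Wv piv];
    exists v.
exists l; split.
  have nW : \forall v \near w, W v by exact: open_nbhs_nbhs.
  by apply: filterS nW => v Wv; apply: lP => //; rewrite rid //;
    exact: covering_sphere.
have Vpw : V (r (pi w)).
  rewrite rid; last exact: covering_sphere.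
  have : (pi @` W) (pi w) by exists w.
  by rewrite VE => -[].
have nV : \forall z \near pi w, V (r z).
  have cr : r z @[z --> pi w] --> r (pi w) by exact: (nbhs_singleton rc).
  by apply: cr; exact: open_nbhs_nbhs.
apply: filterS2 (filterI rS (near_join rS)) (filterI nV rc) => z [Sz nSz] [Vz cz].
have [v Wv piv] := ex z Vz Sz.
have lz := lP z v Wv piv; split; first by rewrite lz.
move=> A; rewrite /= lz => /near_within[B [oB Bv BA]].
have [V' oV' V'E] := opn (B `&` W) (openI oB oW) (@subIsetr _ B W).
have V'z : V' (r z).
  have : (pi @` (B `&` W)) (r z) by exists v.
  by rewrite V'E => -[].
have nV' : \forall z' \near z, V' (r z').
  by apply: (cz V'); apply: open_nbhs_nbhs; split.
rewrite /nbhs /=; apply: filterS2 nV' nSz => z' Vz' Sz'; apply: BA.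
have : (V' `&` S) (r z') by [].
by rewrite -V'E => -[v' [Ov' Wv'] piv']; rewrite (lP z' v').
Qed.

Lemma retract_lift w : exists l : E -> T, (\forall v \near w, l (pi v) = v) /\
    \forall z \near pi w, pi (l z) = retract z /\ {for z, continuous l}.
Proof.
have Sw := covering_sphere w; apply: covering_lift.
- exact: retract_id.
- exact: retract_sphere_near.
- exact: (Ck_at_retract 0).
Qed.

Lemma local_extP (V : normedModType R) (k : nat) (g : T -> V) w (F : E -> V) :
  local_ext pi k g w F <-> Ck_at k F (pi w) /\ \forall v \near w, g v = F (pi v).
Proof.
split=> [[W [oW Ww CF gF]]|[CF gF]].
  by split=> //; apply/Ck_at_openP; exists W.
by have /Ck_at_openP[W [oW Ww CW]] := CF; exists W.
Qed.

Lemma local_ext_near (V : normedModType R) (k : nat) (g : T -> V) w (F : E -> V) :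
  local_ext pi k g w F -> \forall v \near w, local_ext pi k g v F.
Proof.
move=> /local_extP[CF gF].
have H : \forall v \near w, Ck_at k F (pi v) := covering_continuous (Ck_at_near CF).
by apply: filterS2 H (near_join gF) => v ? ?; apply/local_extP.
Qed.

Lemma local_ext_le (V : normedModType R) (k l : nat) (g : T -> V) w (F : E -> V) :
  (k <= l)%N -> local_ext pi l g w F -> local_ext pi k g w F.
Proof.
by move=> kl /local_extP[CF gF]; apply/local_extP; split=> //; exact: Ck_at_le CF.
Qed.

Lemma tderiv_choice (V : normedModType R) (g : T -> V) w (F : E -> V) :
  local_ext pi 1 g w F ->
  local_ext pi 1 g w (xget (fun=> 0) [set G | local_ext pi 1 g w G]).
Proof. by move=> FP; apply: xgetPex; exists F. Qed.

(** Two extensions agree after composition with the retraction, whose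
    derivative fixes tangent vectors. *)
Lemma tderiv_ext (V : normedModType R) (g : T -> V) w (F : E -> V) x :
  local_ext pi 1 g w F -> tangent (pi w) x -> tderiv pi g w x = 'D_x F (pi w).
Proof.
move=> FP tx; rewrite /tderiv; set G := xget _ _.
have : local_ext pi 1 g w G := tderiv_choice FP.
move=> /local_extP[CG gG]; have /local_extP[CF gF] := FP.
have [l [lw ll]] := retract_lift w.
have Sw := covering_sphere w.
have Cr := Ck_at_retract 1 Sw; have dr := Ck_at_diff Cr.
have cl : l z @[z --> pi w] --> w.
  have [_ c] := nbhs_singleton ll; rewrite -[X in _ --> X](nbhs_singleton lw);
    exact: c.
have E2 : \forall v \near w, G (pi v) = F (pi v).
  by apply: filterS2 gG gF => v <- <-.
have E1 : \forall z \near pi w, G (pi (l z)) = F (pi (l z)) by exact: cl E2.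
have E3 : \forall z \near pi w, (G \o retract (q := q)) z = (F \o retract (q :=
  q)) z.
  by apply: filterS2 E1 ll => z e [el _]; rewrite /= -el.
have := near_eq_derive x E3.
have rid := retract_id Sw.
have dF : differentiable F (retract (pi w)) by rewrite rid; exact: Ck_at_diff CF.
have dG : differentiable G (retract (pi w)) by rewrite rid; exact: Ck_at_diff CG.
by rewrite (derive_comp x dr dF) (derive_comp x dr dG) rid derive_retract //
  tproj_id.
Qed.

Lemma tderivD (V : normedModType R) (g : T -> V) w (F : E -> V) x y :
  local_ext pi 1 g w F -> tderiv pi g w (x + y) = tderiv pi g w x + tderiv pi g w y.
Proof.
move=> FP; rewrite /tderiv; set G := xget _ _.
have : local_ext pi 1 g w G := tderiv_choice FP.
move=> /local_extP[/Ck_at_diff dG _].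
by rewrite !(deriveE _ dG) linearD.
Qed.

Lemma tderivZ (V : normedModType R) (g : T -> V) w (F : E -> V) a x :
  local_ext pi 1 g w F -> tderiv pi g w (a *: x) = a *: tderiv pi g w x.
Proof.
move=> FP; rewrite /tderiv; set G := xget _ _.
have : local_ext pi 1 g w G := tderiv_choice FP.
move=> /local_extP[/Ck_at_diff dG _].
by rewrite !(deriveE _ dG) linearZ.
Qed.

Lemma tderiv_chain (U V : normedModType R) (g : T -> V) (c : U -> T) u (x : U)
  (F : E -> V) :
  local_ext pi 1 g (c u) F -> {for u, continuous c} -> differentiable (pi \o c) u ->
  tangent (pi (c u)) ('D_x (pi \o c) u) ->
  differentiable (g \o c) u /\ 'D_x (g \o c) u = tderiv pi g (c u) ('D_x (pi \o
    c) u).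
Proof.
move=> FP cc dc tx; rewrite (tderiv_ext FP tx).
have /local_extP[/Ck_at_diff dF gF] := FP.
have E1 : \forall v \near u, (F \o (pi \o c)) v = (g \o c) v.
  have gFc : \forall v \near u, g (c v) = F (pi (c v)) := cc _ gF.
  by apply: filterS gFc => v /= ->.
have dFc : differentiable (F \o (pi \o c)) u := differentiable_comp dc dF.
have [d _] := near_eq_diff E1 dFc; split=> //.
by rewrite -(near_eq_derive x E1) (derive_comp x dc dF).
Qed.

Lemma sphere_derive_tangent (U : normedModType R) (n : U -> E) u x :
  (\forall v \near u, S (n v)) -> differentiable n u -> tangent (n u) ('D_x n u).
Proof.
move=> Sn dn; have [dc Dc] := derive_conj x dn.
have [_ D1] := derive_mink x dn dn; have [_ D2] := derive_mink x dn dc.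
have E1 : \forall v \near u, mink (n v) (n v) = (fun=> 0) v.
  by apply: filterS Sn => v /sphereP[].
have E2 : \forall v \near u, mink (n v) (conj_vec (n v)) = (fun=> 2) v.
  by apply: filterS Sn => v /sphereP[].
move: D1 D2; rewrite (near_eq_derive x E1) (near_eq_derive x E2) !derive_cst Dc.
rewrite -[mink (n u) (conj_vec _)]mink_conjl [mink (conj_vec _) _]minkC [mink (n
  u) _]minkC.
by set a := mink _ _; set b := mink _ _ => h1 h2; split; rewrite -/a -/b; lra.
Qed.

End covering.

(** * Immersions with a null normal field *)

Section immersions.
Context (R : realType) (p q : nat).
Local Notation E := 'rV[R]_(p.+1 + q.+1).
Local Notation J := (sign_mx p.+1 q.+1 : 'M[R]_(p.+1 + q.+1)).
Implicit Types (F n : 'rV[R]_(p + q) -> E) (u : 'rV[R]_(p + q)).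

Lemma row_rV (m : nat) (x : 'rV[R]_m) : row 0 x = x.
Proof. by apply/rowP => k; rewrite [LHS]mxE. Qed.

Lemma metricE F u : metric F u = jacobian F u *m J *m (jacobian F u)^T.
Proof. by apply/matrixP => i j; rewrite mink_rows mxE. Qed.

Lemma metric_sym F u : (metric F u)^T = metric F u.
Proof. by rewrite metricE !trmx_mul trmxK sign_mx_tr mulmxA. Qed.

Lemma has_signature_unit (G : 'M[R]_(p + q)) : has_signature G -> G \in unitmx.
Proof.
case=> P uP E; have : P *m G *m P^T \in unitmx by rewrite E; exact: sign_mx_unit.
by rewrite !unitmx_mul => /andP[/andP[]].
Qed.

Lemma metric_unit_rank F u : metric F u \in unitmx -> \rank (jacobian F u) =
  (p + q)%N.
Proof.
move=> ug; apply/eqP; rewrite -/(row_free _); apply/row_freeP.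
exists (J *m (jacobian F u)^T *m invmx (metric F u)).
by rewrite !mulmxA -metricE mulmxV.
Qed.

Lemma normal_partE F u v : normal_part F u v =
  v - v *m J *m (jacobian F u)^T *m (invmx (metric F u))^T *m jacobian F u.
Proof.
rewrite /normal_part; congr (_ - _); rewrite [RHS]mulmx_sum_row.
apply: eq_bigr => i _; rewrite -scaler_suml; congr (_ *: _).
rewrite [RHS]mxE; apply: eq_bigr => j _.
by rewrite mulrC [(invmx _)^T _ _]mxE mink_rows row_rV.
Qed.

Lemma normal_part_orthogonal F u v k : metric F u \in unitmx ->
  mink (normal_part F u v) (row k (jacobian F u)) = 0.
Proof.
move=> ug; have -> : mink (normal_part F u v) (row k (jacobian F u)) =
    (normal_part F u v *m J *m (jacobian F u)^T) 0 k.
  by rewrite mink_rows row_rV.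
rewrite normal_partE !mulmxBl; set w := v *m J *m _.
have -> : w *m (invmx (metric F u))^T *m jacobian F u *m J *m (jacobian F u)^T =
    w *m ((invmx (metric F u))^T *m metric F u) by rewrite metricE !mulmxA.
by rewrite trmx_inv metric_sym mulVmx // mulmx1 subrr mxE.
Qed.

Lemma normal_part_null F u v (x : E) :
  (forall k, mink x (row k (jacobian F u)) = 0) ->
  mink (normal_part F u v) x = mink v x.
Proof.
move=> H; rewrite /normal_part minkDl minkNl mink_suml big1 ?subr0 // => i _.
by rewrite mink_suml big1 // => j _; rewrite minkZl (minkC _ x) H mulr0.
Qed.

Lemma mean_curvature_orthogonal F u k : metric F u \in unitmx ->
  mink (mean_curvature F u) (row k (jacobian F u)) = 0.
Proof.
move=> ug; rewrite /mean_curvature minkZl mink_suml big1 ?mulr0 // => i _.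
by rewrite mink_suml big1 // => j _; rewrite minkZl normal_part_orthogonal ?mulr0.
Qed.

(** Differentiating [mink (D_i F) n = 0] turns second derivatives of the
    immersion into first derivatives of the normal field. *)
Lemma mean_curvature_normal F n u :
  (forall i, differentiable ('D_(delta_mx 0 i) F) u) -> differentiable F u ->
  differentiable n u ->
  (\forall v \near u, forall i, mink ('D_(delta_mx 0 i) F v) (n v) = 0) ->
  mink (mean_curvature F u) (n u) =
  - ((p + q)%:R)^-1 *
    \tr (invmx (metric F u) *m (jacobian F u *m J *m (jacobian n u)^T)^T).
Proof.
move=> ddF dF dn Hn.
have H0 k : mink (n u) (row k (jacobian F u)) = 0.
  by rewrite row_jacobian // minkC; exact: (nbhs_singleton Hn).
rewrite /mean_curvature minkZl mulNr -mulrN; congr (_ * _).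
rewrite mink_suml /mxtrace -sumrN; apply: eq_bigr => i _.
rewrite mink_suml [in RHS]mxE -sumrN; apply: eq_bigr => j _.
rewrite minkZl -mulrN; congr (_ * _).
rewrite /second_form normal_part_null // [in RHS]mxE mink_rows !row_jacobian //.
have [_ D] := derive_mink (delta_mx 0 j) (ddF i) dn.
have E0 : \forall v \near u, mink ('D_(delta_mx 0 i) F v) (n v) = (fun=> 0) v.
  by apply: filterS Hn => v /(_ i).
move: D; rewrite (near_eq_derive _ E0) derive_cst => /esym/eqP.
by rewrite addr_eq0 => /eqP.
Qed.

(** The field [n] is null and orthogonal to its own derivatives, so the term
    [a *m n u] of the differential contributes neither to the metric nor to the
    second fundamental form along [n]: both are governed by [A]. *)
Section factorized.
Context (F n : 'rV[R]_(p + q) -> E) (u : 'rV[R]_(p + q)) (A : 'M[R]_(p + q))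
  (a : 'cV[R]_(p + q)).
Hypothesis Sn : \forall v \near u, sphere_prod R p q (n v).
Hypothesis dn : differentiable n u.
Hypothesis rn : \rank (jacobian n u) = (p + q)%N.
Hypothesis FA : jacobian F u = A *m jacobian n u + a *m n u.

Local Notation B := (jacobian n u).
Let Snu : sphere_prod R p q (n u) := nbhs_singleton Sn.

Lemma Gauss_tangent i : tangent (n u) (row i B).
Proof. by rewrite row_jacobian //; exact: sphere_derive_tangent. Qed.

Lemma Gauss_normal : n u *m J *m B^T = 0.
Proof.
apply/rowP => i; rewrite mink_rows mxE minkC row_rV.
by have [] := Gauss_tangent i.
Qed.

Lemma Gauss_null : n u *m J *m (n u)^T = 0.
Proof. by apply: mxE00; rewrite -minkE mxE; have /sphereP[] := Snu. Qed.

Lemma factorized_cross : jacobian F u *m J *m B^T = A *m (B *m J *m B^T).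
Proof.
move: FA Gauss_normal; move: (jacobian F u) B (n u) => w b x -> H.
have -> : (A *m b + a *m x) *m J *m b^T = A *m (b *m J *m b^T) + a *m (x *m J *m
  b^T).
  by rewrite !mulmxDl !mulmxA.
by rewrite H mulmx0 addr0.
Qed.

Lemma factorized_metric : metric F u = A *m (B *m J *m B^T) *m A^T.
Proof.
move: FA Gauss_normal Gauss_null factorized_cross; rewrite metricE.
move: (jacobian F u) B (n u) => w b x wE xb xx wb.
have wT : w^T = b^T *m A^T + x^T *m a^T by rewrite wE linearD /= !trmx_mul.
have wx : w *m J *m x^T = 0.
  have bx : b *m J *m x^T = 0.
    have -> : b *m J *m x^T = (x *m J *m b^T)^T.
      by rewrite !trmx_mul trmxK sign_mx_tr mulmxA.
    by rewrite xb trmx0.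
  have -> : w *m J *m x^T = A *m (b *m J *m x^T) + a *m (x *m J *m x^T).
    by rewrite wE !mulmxDl !mulmxA.
  by rewrite bx xx !mulmx0 addr0.
by rewrite wT mulmxDr !mulmxA wb wx mul0mx addr0 !mulmxA.
Qed.

Lemma Gauss_gram : exists2 P : 'M[R]_(p + q), P \in unitmx &
  B *m J *m B^T = P *m sign_mx p q *m P^T.
Proof.
have [C FC] := orthonormal_frame_exists Snu.
have [P uP BP] := frame_change FC Gauss_tangent rn.
exists P => //; have [_ CC _] := FC.
by rewrite BP trmx_mul -CC !mulmxA.
Qed.

Lemma Gauss_gram_unit : B *m J *m B^T \in unitmx.
Proof.
have [P uP ->] := Gauss_gram.
by rewrite !unitmx_mul unitmx_tr uP sign_mx_unit.
Qed.

Lemma factorized_unit : (metric F u \in unitmx) = (A \in unitmx).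
Proof. by rewrite factorized_metric !unitmx_mul unitmx_tr Gauss_gram_unit andbT
  andbb. Qed.

Lemma factorized_signature : A \in unitmx -> has_signature (metric F u).
Proof.
move=> uA; have [P uP GP] := Gauss_gram;
  have uAP : A *m P \in unitmx by rewrite unitmx_mul uA.
exists (invmx (A *m P)); first by rewrite unitmx_inv.
rewrite factorized_metric GP.
have -> : A *m (P *m sign_mx p q *m P^T) *m A^T = (A *m P) *m sign_mx p q *m (A
  *m P)^T.
  by rewrite trmx_mul !mulmxA.
move: (A *m P) uAP => Q uQ.
by rewrite !mulmxA mulVmx // mul1mx -mulmxA -trmx_mul mulVmx // trmx1 mulmx1.
Qed.

(** With [G] the Gram matrix of [B], the metric is [A G A^T] and the matrix of
    products of [dF] with [dn] is [A G]; their quotient has the trace of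
    [A^-1]. *)
Lemma factorized_curvature : A \in unitmx ->
  (forall i, differentiable ('D_(delta_mx 0 i) F) u) -> differentiable F u ->
  (\forall v \near u, forall i, mink ('D_(delta_mx 0 i) F v) (n v) = 0) ->
  mink (mean_curvature F u) (n u) = - ((p + q)%:R)^-1 * \tr (invmx A).
Proof.
move=> uA ddF dF Hn; rewrite mean_curvature_normal //; congr (_ * _).
rewrite factorized_cross factorized_metric.
have GT : (B *m J *m B^T)^T = B *m J *m B^T by rewrite !trmx_mul trmxK sign_mx_tr
  mulmxA.
rewrite trmx_mul GT; move: (B *m J *m B^T) Gauss_gram_unit {GT} => G uG.
have uAG : A *m G \in unitmx by rewrite unitmx_mul uA.
have uAT : A^T \in unitmx by rewrite unitmx_tr.
have -> : invmx (A *m G *m A^T) = invmx A^T *m (invmx G *m invmx A).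
  have K : (invmx A^T *m (invmx G *m invmx A)) *m (A *m G *m A^T) = 1%:M.
    by rewrite !mulmxA mulmxKV // -!mulmxA [invmx G *m _]mulmxA mulVmx // mul1mx
      mulVmx.
  have uAGA : A *m G *m A^T \in unitmx by rewrite unitmx_mul uAG.
  by rewrite -[LHS]mul1mx -K mulmxK.
by rewrite mxtrace_mulC mulmxA mulmxK // mulmxA mulmxV // mul1mx.
Qed.

(** As [A] is invertible, the tangent space of the sphere product at [n u] lies
    in the span of [dF] and [n u]. So [h] is a combination of [n u] and
    [conj_vec (n u)], and orthogonality to [n u] excludes the latter. *)
Lemma normal_null_line (h : E) : A \in unitmx ->
  (forall k, mink h (row k (jacobian F u)) = 0) -> mink h (n u) = 0 -> mink h h = 0.
Proof.
move=> uA hF hn.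
have /sphereP[n0 n2] := Snu.
have hB : h *m J *m B^T = 0.
  have E1 : h *m J *m (jacobian F u)^T = 0.
    apply/rowP => k; rewrite mink_rows mxE row_rV.
    exact: hF.
  have E2 : h *m J *m (n u)^T = 0 by apply: mxE00; rewrite -minkE mxE.
  move: E1; rewrite FA linearD /= !trmx_mul mulmxDr !mulmxA E2 mul0mx addr0 => E1.
  have uAT : A^T \in unitmx by rewrite unitmx_tr.
  by rewrite -[LHS](mulmxK uAT) E1 mul0mx.
have [C FC] := orthonormal_frame_exists Snu.
have [P uP BP] := frame_change FC Gauss_tangent rn.
have t0 : tproj (n u) h = 0.
  have [_ _ <-] := FC; rewrite !mulmxA.
  have uPT : P^T \in unitmx by rewrite unitmx_tr.
  have hC : h *m J *m C^T *m P^T = 0.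
    have -> : h *m J *m C^T *m P^T = h *m J *m (P *m C)^T by rewrite trmx_mul
      !mulmxA.
    by rewrite -BP.
  have -> : h *m J *m C^T = 0 by rewrite -[LHS](mulmxK uPT) hC mul0mx.
  by rewrite !mul0mx.
move: t0; rewrite tprojE hn mul0r scale0r subr0 => /eqP.
by rewrite subr_eq0 => /eqP ->; rewrite minkZl minkZr n0 !mulr0.
Qed.

End factorized.

End immersions.

(** * The gradient of the potential *)

Section gradient.
Context (R : realType) (p q : nat) (T : topologicalType).
Local Notation E := 'rV[R]_(p.+1 + q.+1).
Local Notation S := (sphere_prod R p q).
Context (pi : T -> E) (cpi : covering_map S pi).

Lemma Ck_at_tproj k (y x : E) : Ck_at k (fun z => tproj z x) y.
Proof.
have Cx := Ck_at_cst k x y; have Cid := @Ck_at_id R (p.+1 + q.+1) k y.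
have Cc := Ck_at_conj Cid.
have Ch := @Ck_at_cst R (p.+1 + q.+1) R k 2^-1 y.
have Cm := @Ck_at_cst R (p.+1 + q.+1) R k (-1) y.
have H : Ck_at k (fun z => x + (-1) *: ((mink x (conj_vec z) * 2^-1) *: z) +
    (-1) *: ((mink x z * 2^-1) *: conj_vec z)) y.
  apply: Ck_at_add; first apply: Ck_at_add => //.
    apply: Ck_at_scale => //; apply: Ck_at_scale => //.
    by apply: Ck_at_mul => //; exact: Ck_at_mink.
  apply: Ck_at_scale => //; apply: Ck_at_scale => //.
  by apply: Ck_at_mul => //; exact: Ck_at_mink.
by apply: Ck_at_near_eq H; apply: near_always => z; rewrite tprojE !scaleN1r.
Qed.

(** The formula defining [grad], with the derivative of an extension expanded
    along the basis vectors so that its regularity in [z] can be read off. *)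
Definition grad_ext (F : E -> R) (z : E) : E :=
  conj_vec (\row_j \sum_l (tproj z (delta_mx 0 j)) 0 l * 'D_(delta_mx 0 l) F z).

Lemma Ck_at_grad_ext k (F : E -> R) y : Ck_at k.+1 F y -> Ck_at k (grad_ext F) y.
Proof.
move=> [_ pF]; apply: Ck_at_conj; apply/Ck_at_mxP => i j.
have H : Ck_at k (fun z => \sum_l (tproj z (delta_mx 0 j)) 0 l * 'D_(delta_mx 0
  l) F z) y.
  apply: Ck_at_sum => l; apply: Ck_at_mul; last exact: pF.
  by have /Ck_at_mxP := Ck_at_tproj k y (delta_mx 0 j); exact.
by apply: Ck_at_near_eq H; apply: near_always => z; rewrite mxE.
Qed.

Lemma local_ext_grad k (s : T -> R) w (F : E -> R) :
  local_ext pi k.+1 s w F -> local_ext pi k (grad pi s) w (grad_ext F).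
Proof.
move=> FP; apply/local_extP; split.
  by have /local_extP[CF _] := FP; exact: Ck_at_grad_ext.
apply: filterS (local_ext_near cpi FP) => v /(local_ext_le (isT : (1 <= k.+1)%N))
  FPv.
rewrite /grad /grad_ext; congr conj_vec; apply/rowP => j; rewrite !mxE.
have Sv := covering_sphere cpi v.
rewrite (tderiv_ext cpi FPv (tproj_tangent Sv _)).
have /local_extP[/Ck_at_diff dF _] := FPv.
rewrite (deriveE _ dF) [X in 'd F _ X]row_sum_delta linear_sum /=.
by apply: eq_bigr => i _; rewrite linearZ /= (deriveE _ dF).
Qed.

Lemma grad_mink (s : T -> R) w (F : E -> R) v : local_ext pi 1 s w F ->
  mink (grad pi s w) v = tderiv pi s w (tproj (pi w) v).
Proof.
move=> FP; rewrite /grad mink_conjl mink_conjr dotC /dot.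
rewrite (@row_linear_sum R _ R (fun v => tderiv pi s w (tproj (pi w) v))).
- by rewrite mxE; apply: eq_bigr => j _; rewrite !mxE.
- by move=> x y; rewrite tprojD (tderivD _ _ FP).
- by move=> a x; rewrite tprojZ (tderivZ _ _ FP).
Qed.

Lemma grad_tangent (s : T -> R) w (F : E -> R) : local_ext pi 1 s w F ->
  tangent (pi w) (grad pi s w).
Proof.
move=> FP; have Sw := covering_sphere cpi w; have [h1 h2] := tproj_normal Sw.
rewrite /tangent !(grad_mink _ FP) h1 h2 -[X in tderiv _ _ _ X](scale0r (0 : E)).
by rewrite (tderivZ _ _ FP) scale0r.
Qed.

(** The endomorphism whose matrix in the basis [row_base] is [root_endo]. *)
Definition shape_fun (s t : T -> R) w (X : E) : E :=
  t w *: X + s w *: conj_vec X + (2 : R) *: hess pi s w (tproj (pi w) X).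

Section at_point.
Context (s t : T -> R) (w : T) (Fs : E -> R).
Hypothesis Hs : local_ext pi 2 s w Fs.

Let Hg : local_ext pi 1 (grad pi s) w (grad_ext Fs) := local_ext_grad Hs.

Lemma shape_fun_tangent X : tangent (pi w) X -> tangent (pi w) (shape_fun s t w X).
Proof.
move=> tX; apply: tangentD; first apply: tangentD; apply: tangentZ => //.
  exact: tangent_conj.
exact: tproj_tangent (covering_sphere cpi w) _.
Qed.

Lemma mul_shape_mx X : X *m lin1_mx (shape_fun s t w) = shape_fun s t w X.
Proof.
apply: mul_lin1_mx => [x y|a x]; rewrite /shape_fun /hess.
  rewrite tprojD (tderivD _ _ Hg) tprojD conj_vecD !scalerDr.
  by rewrite -[RHS]addrACA; congr (_ + _); exact: addrACA.
rewrite tprojZ (tderivZ _ _ Hg) tprojZ conj_vecZ !scalerDr !scalerA.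
by rewrite !(mulrC a).
Qed.

(** The component of [D (grad s)] along [conj_vec nu] follows from
    differentiating [mink (grad s) nu = 0], as [mink nu (conj_vec nu) = 2]. *)
Lemma grad_chain (U : normedModType R) (c : U -> T) (u x : U) :
  c u = w -> {for u, continuous c} -> differentiable (pi \o c) u ->
  let X := 'D_x (pi \o c) u in
  differentiable (grad pi s \o c) u /\
  2 *: 'D_x (grad pi s \o c) u = 2 *: hess pi s w X +
    mink ('D_x (grad pi s \o c) u) (conj_vec (pi w)) *: pi w -
    'D_x (s \o c) u *: conj_vec (pi w).
Proof.
move=> cu cc dc X.
have Sw := covering_sphere cpi w.
have tX : tangent (pi w) X.
  rewrite -cu; apply: (@sphere_derive_tangent R p q _ (pi \o c)) => //.
  by apply: near_always => v; exact: (covering_sphere cpi (c v)).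
have Hs1 : local_ext pi 1 s w Fs := local_ext_le (isT : (1 <= 2)%N) Hs.
have Hgc : local_ext pi 1 (grad pi s) (c u) (grad_ext Fs) by rewrite cu.
have Hsc : local_ext pi 1 s (c u) Fs by rewrite cu.
have tXc : tangent (pi (c u)) X by rewrite cu.
have [dg Dg] := tderiv_chain cpi Hgc cc dc tXc.
have [ds Ds] := tderiv_chain cpi Hsc cc dc tXc.
split=> //; rewrite Dg Ds cu -/X.
have nz : mink (tderiv pi (grad pi s) w X) (pi w) = - tderiv pi s w X.
  have [_ D] := derive_mink x dg dc.
  have E0 : \forall v \near u,
    mink ((grad pi s \o c) v) ((pi \o c) v) = (fun=> 0) v.
    have Hn : \forall v \near u, local_ext pi 1 s (c v) Fs.
      exact: (cc _ (local_ext_near cpi Hsc)).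
    by apply: filterS Hn => v /grad_tangent[].
  move: D; rewrite (near_eq_derive x E0) derive_cst Dg cu -/X /= cu.
  rewrite (grad_mink _ Hs1) (tproj_id tX) => /esym/eqP.
  by rewrite addr_eq0 => /eqP.
rewrite /hess; set Y := tderiv pi (grad pi s) w X in nz *.
rewrite tprojE nz; set b := mink Y _; set d := tderiv _ _ _ _.
move: (pi w) (conj_vec (pi w)) => y y'.
by apply/rowP => i; rewrite !mxE; field.
Qed.

End at_point.

(** The normal component of [D (grad s)] along [conj_vec nu] cancels the
    derivative of [s], leaving the tangential part and a multiple of [nu]. *)
Lemma phi_chain (U : normedModType R) (s t : T -> R) (c : U -> T) (u x : U)
    (Fs Ft : E -> R) :
  local_ext pi 2 s (c u) Fs -> local_ext pi 1 t (c u) Ft ->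
  {for u, continuous c} -> differentiable (pi \o c) u ->
  differentiable (phi pi s t \o c) u /\
  exists a : R, 'D_x (phi pi s t \o c) u =
    'D_x (pi \o c) u *m lin1_mx (shape_fun s t (c u)) + a *: pi (c u).
Proof.
move=> Hs Ht cc dc.
have Hs1 : local_ext pi 1 s (c u) Fs := local_ext_le (isT : (1 <= 2)%N) Hs.
set X := 'D_x (pi \o c) u.
have tX : tangent (pi (c u)) X.
  apply: (@sphere_derive_tangent R p q _ (pi \o c)) => //.
  by apply: near_always => v; exact: (covering_sphere cpi (c v)).
have [dg Dg] := grad_chain Hs x erefl cc dc.
have [ds Ds] := tderiv_chain cpi Hs1 cc dc tX.
have [dt Dt] := tderiv_chain cpi Ht cc dc tX.
have [dcc Dcc] := derive_conj x dc.
have [d1 D1] := derive_scale x dt dc.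
have [d2 D2] := derive_scale x ds dcc.
have d2c := differentiable_cst (2 : R) u.
have [d3 D3] := derive_scale x d2c dg.
have [d12 D12] := derive_add x d1 d2.
have [d D] := derive_add x d12 d3.
split; first exact: d.
rewrite (mul_shape_mx _ Hs).
exists ('D_x (t \o c) u + mink ('D_x (grad pi s \o c) u) (conj_vec (pi (c u)))).
rewrite [LHS]D D12 D1 D2 D3 derive_cst scale0r add0r Dg Dcc -/X /shape_fun.
rewrite (tproj_id tX) /=.
set a := 'D_x _ _; set b := mink _ _; set e := 'D_x _ _.
move: (hess _ _ _ _) (conj_vec X) (pi (c u)) (conj_vec (pi (c u))) => h X' y y'.
by apply/rowP => i; rewrite !mxE; ring.
Qed.

End gradient.

(** * Immersions built from a potential are marginally trapped *)

Section direct.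
Context (R : realType) (p q : nat) (T : topologicalType).
Local Notation E := 'rV[R]_(p.+1 + q.+1).
Local Notation S := (sphere_prod R p q).
Context (pi : T -> E) (cpi : covering_map S pi).

Section parametrization.
Context (s t : T -> R) (c : 'rV[R]_(p + q) -> T) (u : 'rV[R]_(p + q))
  (Fs Ft : E -> R).
Hypothesis Hs : local_ext pi 2 s (c u) Fs.
Hypothesis Ht : local_ext pi 1 t (c u) Ft.
Hypothesis cc : \forall v \near u, {for v, continuous c}.
Hypothesis dc : \forall v \near u, differentiable (pi \o c) v.
Hypothesis rc : \rank (jacobian (pi \o c) u) = (p + q)%N.

Local Notation F := (phi pi s t \o c).
Local Notation n := (pi \o c).
Local Notation root := (root_endo pi s t (c u)).

Lemma Gauss_sphere : \forall v \near u, S (n v).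
Proof. by apply: near_always => v; exact: (covering_sphere cpi (c v)). Qed.

Lemma phi_factorized : differentiable F u /\
  exists (A : 'M[R]_(p + q)) (a : 'cV[R]_(p + q)),
  [/\ jacobian F u = A *m jacobian n u + a *m n u,
      (A \in unitmx) = (root \in unitmx) &
      root \in unitmx -> \tr (invmx A) = \tr (invmx root)].
Proof.
have cu := nbhs_singleton cc; have du := nbhs_singleton dc.
have dF : differentiable F u by have [] := phi_chain cpi 0 Hs Ht cu du.
split=> //.
have tC i : tangent (n u) (row i (jacobian n u)) by exact: Gauss_tangent
  Gauss_sphere du _.
have Sn : S (n u) := nbhs_singleton Gauss_sphere.
have tA v : tangent (pi (c u)) v ->
  tangent (pi (c u)) (v *m lin1_mx (shape_fun pi s t (c u))).
  by move=> tv; rewrite (mul_shape_mx cpi t Hs); exact: shape_fun_tangent.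
have [A [CA uA trA]] := endo_basis_change Sn tC rc tA.
have H i : exists a : R, row i (jacobian F u) =
    row i (jacobian n u) *m lin1_mx (shape_fun pi s t (c u)) + a *: n u.
  have [_ [a Ha]] := phi_chain cpi (delta_mx 0 i) Hs Ht cu du.
  exists a; apply: (etrans (row_jacobian i dF)); apply: (etrans Ha).
  by congr (_ *m _ + _); exact: (esym (row_jacobian i du)).
pose a : 'cV[R]_(p + q) := \col_i sval (cid (H i)).
exists A, a; split=> //.
rewrite -CA; apply/row_matrixP => i;
  rewrite (svalP (cid (H i))) linearD /= !row_mul.
congr (_ + _); apply/rowP => j; rewrite !mxE big_ord1 !mxE.
by congr (_ * _); congr (n u _ _); apply: ord_inj.
Qed.

Lemma phi_orthogonal : \forall v \near u, forall i, mink ('D_(delta_mx 0 i) F v)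
  (n v) = 0.
Proof.
have cu := nbhs_singleton cc.
have Hs' : \forall v \near u, local_ext pi 2 s (c v) Fs :=
  cu _ (local_ext_near cpi Hs).
have Ht' : \forall v \near u, local_ext pi 1 t (c v) Ft :=
  cu _ (local_ext_near cpi Ht).
apply: filterS2 (filterI cc dc) (filterI Hs' Ht') => v [cv dv] [Hsv Htv] i.
have [_ [a ->]] := phi_chain cpi (delta_mx 0 i) Hsv Htv cv dv.
have Sv := covering_sphere cpi (c v).
have tX : tangent (pi (c v)) ('D_(delta_mx 0 i) n v).
  apply: (@sphere_derive_tangent R p q _ n) => //.
  by apply: near_always => x; exact: (covering_sphere cpi (c x)).
have [tXA _] := shape_fun_tangent cpi s t tX.
rewrite minkDl minkZl (mul_shape_mx cpi t Hsv) [X in X + _]tXA add0r /=.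
by have /sphereP[-> _] := Sv; rewrite mulr0.
Qed.

Hypothesis ddF : forall i, differentiable ('D_(delta_mx 0 i) F) u.

Lemma phi_metric_unit : (metric F u \in unitmx) = (root \in unitmx).
Proof.
have [dF [A [a [FA <- _]]]] := phi_factorized.
exact: (factorized_unit Gauss_sphere (nbhs_singleton dc) rc FA).
Qed.

Lemma phi_curvature : root \in unitmx ->
  mink (mean_curvature F u) (n u) = - ((p + q)%:R)^-1 * \tr (invmx root).
Proof.
move=> ur; have [dF [A [a [FA uA <-//]]]] := phi_factorized.
have {}uA : A \in unitmx by rewrite uA.
have du := nbhs_singleton dc.
exact: (factorized_curvature Gauss_sphere du rc FA uA ddF dF phi_orthogonal).
Qed.

Lemma phi_trapped : root \in unitmx -> \tr
  (invmx root) = 0 -> marginally_trapped_at F u.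
Proof.
move=> ur tr0; have um : metric F u \in unitmx by rewrite phi_metric_unit.
have [dF [A [a [FA uA _]]]] := phi_factorized.
have {}uA : A \in unitmx by rewrite uA.
have du := nbhs_singleton dc.
split; first exact: metric_unit_rank.
  exact: (factorized_signature Gauss_sphere du rc FA uA).
apply: (normal_null_line Gauss_sphere du rc FA uA).
  by move=> k; exact: mean_curvature_orthogonal.
by rewrite phi_curvature // tr0 mulr0.
Qed.

End parametrization.

Lemma Ck_at_pull_scalar k (g : T -> R) m (c : 'rV[R]_m -> T) u (F : E -> R) :
  local_ext pi k g (c u) F -> {for u, continuous c} -> Ck_at k (pi \o c) u ->
  Ck_at k (g \o c) u.
Proof.
move=> /local_extP[CF gF] cc Cc.
have gFc : \forall v \near u, F (pi (c v)) = g (c v).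
  have H : \forall v \near u, g (c v) = F (pi (c v)) := cc _ gF.
  by apply: filterS H => v ->.
by apply: Ck_at_near_eq gFc _; exact: (@Ck_at_comp_scalar _ _ _ _ F (pi \o c)).
Qed.

Lemma Ck_at_pull k a b (g : T -> 'M[R]_(a, b)) m (c : 'rV[R]_m -> T) u
  (F : E -> 'M[R]_(a, b)) :
  local_ext pi k g (c u) F -> {for u, continuous c} -> Ck_at k (pi \o c) u ->
  Ck_at k (g \o c) u.
Proof.
move=> /local_extP[CF gF] cc Cc.
have gFc : \forall v \near u, F (pi (c v)) = g (c v).
  have H : \forall v \near u, g (c v) = F (pi (c v)) := cc _ gF.
  by apply: filterS H => v ->.
by apply: Ck_at_near_eq gFc _; exact: (@Ck_at_comp _ _ _ _ _ _ F (pi \o c)).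
Qed.

Lemma phi_immersion (Om : set T) (s t : T -> R) :
  open Om -> Ck_on pi 4 Om s -> is_root pi Om s t ->
  marginally_trapped_immersion pi Om (phi pi s t).
Proof.
move=> oOm Cs [Ct Hroot] U c [oU injc cc _ [Cc rc]] cOm.
have nU u : U u -> \forall v \near u, U v by move=> Uu; exact: open_nbhs_nbhs.
have Cphi u : U u -> Ck_at 2 (phi pi s t \o c) u.
  move=> Uu; have Ou : Om (c u) by apply: cOm; exists u.
  have [Fs Hs] := Cs _ Ou; have [Ft Ht] := Ct _ Ou.
  have cu := cc _ Uu.
  have Cu : Ck_at 2 (pi \o c) u by move/(Ck_atP _ _ oU) : Cc; apply.
  have Hs2 := local_ext_le (isT : (2 <= 4)%N) Hs.
  have Hg := local_ext_grad cpi (local_ext_le (isT : (3 <= 4)%N) Hs).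
  apply: Ck_at_add; first apply: Ck_at_add.
  - by apply: Ck_at_scale => //; exact: (Ck_at_pull_scalar Ht cu Cu).
  - apply: Ck_at_scale; first exact: (Ck_at_pull_scalar Hs2 cu Cu).
    exact: Ck_at_conj.
  - apply: Ck_at_scale; first exact: Ck_at_cst.
    exact: (Ck_at_pull Hg cu Cu).
split=> [|u Uu]; first by apply/(Ck_atP _ _ oU).
have Ou : Om (c u) by apply: cOm; exists u.
have [Fs Hs] := Cs _ Ou; have [Ft Ht] := Ct _ Ou.
have [ur tr0] := Hroot _ Ou.
have ncc : \forall v \near u, {for v, continuous c} by apply: filterS (nU _ Uu).
have ndc : \forall v \near u, differentiable (pi \o c) v.
  by have [dd _] := Cc; apply: filterS (nU _ Uu).
apply: (phi_trapped (local_ext_le (isT : (2 <= 4)%N) Hs) (local_ext_le (isT : (1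
  <= 2)%N) Ht)) => //.
  exact: rc.
by move=> i; have [_ /(_ i) [H _]] := Cphi u Uu; exact: (nbhs_singleton H).
Qed.

End direct.

(** * Regularity and local inversion of the Gauss map *)

Section Gauss_map.
Context (R : realType) (p q : nat).
Local Notation E := 'rV[R]_(p.+1 + q.+1).
Local Notation S := (sphere_prod R p q).
Local Notation J := (sign_mx p.+1 q.+1 : 'M[R]_(p.+1 + q.+1)).

(** The rows of [w] are projected to the tangent space of the sphere product
    along [y]. As [y] is null this does not change their Gram matrix, so the
    projections form a basis, and the coordinates of [x] in it are found by
    pairing [x] with [w]. *)
Lemma tangent_coordinates (y x : E) (w : 'M[R]_(p + q, p.+1 + q.+1)) :
  S y -> (forall i, mink (row i w) y = 0) -> w *m J *m w^T \in unitmx ->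
    tangent y x ->
  x = x *m J *m w^T *m invmx (w *m J *m w^T) *m (w + -2^-1 *: (w *m y^T *m y)).
Proof.
move=> Sy wy ug tx; have [y0 y2] := (sphereP y).1 Sy.
set g := w *m J *m w^T in ug *; set W := w + _.
have rowW i : row i W = tproj y (row i w).
  rewrite tprojE wy mul0r scale0r subr0 mink_conjr /dot -row_mul.
  rewrite /W linearD /=; congr (_ + _); apply/rowP => j.
  by rewrite !mxE big_ord1 !mxE; field.
have tW i : tangent y (row i W) by rewrite rowW; exact: tproj_tangent.
have gW : W *m J *m W^T = g.
  apply/matrixP => i j;
    rewrite !mink_rows !rowW tproj_sym (tproj_id (tproj_tangent Sy _)).
  by rewrite tprojE wy mul0r scale0r subr0 minkDr minkNr minkZr wy mulr0 subr0.
have xW : x *m J *m W^T = x *m J *m w^T.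
  apply/rowP => j; rewrite !mink_rows row_rV rowW -tproj_sym tproj_id //.
have rW : \rank W = (p + q)%N.
  apply/eqP; rewrite -/(row_free _); apply/row_freeP.
  by exists (J *m W^T *m invmx g); rewrite !mulmxA gW mulmxV.
have [C FC] := orthonormal_frame_exists Sy.
have [P uP WP] := frame_change FC tW rW.
have xE : x = x *m (J *m C^T *m sign_mx p q) *m invmx P *m W.
  rewrite WP [RHS]mulmxA mulmxKV //; exact: esym (frame_decomp FC tx).
rewrite -xW; move: xE; set c := x *m _ *m _ => xE.
have -> : x *m J *m W^T = c *m g by rewrite {1}xE -gW !mulmxA.
by rewrite mulmxK.
Qed.

(** Differentiating [mink n (D_i F) = 0] expresses the derivatives of [n] by
    [n] itself and the first two derivatives of [F], so that [n] is only one
    order less regular than [F]. *)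
Lemma Gauss_smooth k (F n : 'rV[R]_(p + q) -> E) u :
  Ck_at k.+1 F u ->
  (\forall v \near u, [/\ S (n v), differentiable n v, metric F v \in unitmx &
     forall i, mink (n v) ('D_(delta_mx 0 i) F v) = 0]) ->
  Ck_at k n u.
Proof.
elim: k => [|k IH] CF H.
  by apply: filterS H => v [_ dn _ _]; exact: differentiable_continuous.
have Cn := IH (Ck_at_le (leqnSn k.+1) CF) H.
split; first by apply: filterS H => v [].
move=> j.
pose b v : 'rV[R]_(p + q) :=
  \row_i (-1 * mink (n v) ('D_(delta_mx 0 j) ('D_(delta_mx 0 i) F) v)).
pose D v := b v *m invmx (metric F v) *m
  (jacobian F v + - 2^-1 *: (jacobian F v *m (n v)^T *m n v)).
have CJ : Ck_at k.+1 (jacobian F) u := Ck_at_jacobian CF.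
have CJk : Ck_at k (jacobian F) u := Ck_at_le (leqnSn k) CJ.
have [_ _ um _] := nbhs_singleton H.
have CD : Ck_at k D u.
  apply: Ck_at_mulmx; first apply: Ck_at_mulmx.
  - apply/Ck_at_mxP => l i.
    have Hi : Ck_at k (fun v => -1 * mink (n v) ('D_(delta_mx 0 j) ('D_(delta_mx
      0 i) F) v)) u.
      apply: Ck_at_mul; first exact: Ck_at_cst.
      apply: Ck_at_mink => //; have [_ /(_ i) [_ /(_ j)]] := CF; exact.
    by apply: Ck_at_near_eq Hi; apply: near_always => v; rewrite mxE.
  - apply: Ck_at_invmx => //.
    have Hm : Ck_at k (fun v => jacobian F v *m J *m (jacobian F v)^T) u.
      apply: Ck_at_mulmx; last exact: Ck_at_trmx.
      by apply: Ck_at_mulmx => //; exact: Ck_at_cst.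
    by apply: Ck_at_near_eq Hm; apply: near_always => v; rewrite metricE.
  - apply: Ck_at_add => //; apply: Ck_at_scale; first exact: Ck_at_cst.
    by apply: Ck_at_mulmx => //; apply: Ck_at_mulmx => //; exact: Ck_at_trmx.
apply: Ck_at_near_eq CD.
have [dF dpF] := CF.
have ddF : \forall v \near u, forall i, differentiable ('D_(delta_mx 0 i) F) v.
  apply: (@filter_forall _ _ (fun i v => differentiable ('D_(delta_mx 0 i) F) v)
    (nbhs u)).
  by move=> i; have [] := dpF i.
have dF1 : \forall v \near u, differentiable F v := dF.
apply: filterS2 (filterI dF1 ddF) (near_join H) => v [dFv ddFv] Hv.
have [Sv dnv umv nv] := nbhs_singleton Hv.
have Sn : \forall x \near v, S (n x) by apply: filterS Hv => x [].
have tv := sphere_derive_tangent (delta_mx 0 j) Sn dnv.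
have wn i : mink (row i (jacobian F v)) (n v) = 0.
  by rewrite row_jacobian // minkC.
have um' : jacobian F v *m J *m (jacobian F v)^T \in unitmx by rewrite -metricE.
rewrite [RHS](tangent_coordinates Sv wn um' tv) /D -metricE; congr (_ *m _ *m _).
apply/rowP => i; rewrite mink_rows row_rV row_jacobian // mxE mulN1r.
have [_ Dm] := derive_mink (delta_mx 0 j) dnv (ddFv i).
have E0 : \forall x \near v, mink (n x) ('D_(delta_mx 0 i) F x) = (fun=> 0) x.
  by apply: filterS Hv => x [].
move: Dm; rewrite (near_eq_derive _ E0) derive_cst => /esym/eqP.
by rewrite addr_eq0 => /eqP ->.
Qed.

(** The chord [a - b] is orthogonal to [a + b] and to its conjugate. If it is
    also normal at [y], it vanishes as soon as both components of [a + b] form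
    an acute angle with those of [y], which the two inequalities express. *)
Lemma sphere_chart (y a b : E) : S a -> S b ->
  0 < mink y (a + b) + mink y (conj_vec (a + b)) ->
  0 < mink y (conj_vec (a + b)) - mink y (a + b) ->
  tproj y (a - b) = 0 -> a = b.
Proof.
move=> /sphereP[a0 a2] /sphereP[b0 b2] h1 h2 ht.
set l := mink (a - b) (conj_vec y) / 2; set k := mink (a - b) y / 2.
have dE : a - b = l *: y + k *: conj_vec y.
  by move/eqP: ht; rewrite tprojE -/l -/k -addrA -opprD subr_eq0 => /eqP.
set m := mink y (a + b) in h1 h2; set m' := mink y (conj_vec (a + b)) in h1 h2.
have e1 : mink (a - b) (a + b) = 0.
  by rewrite minkDl minkNl !minkDr (minkC b a) a0 b0; ring.
have e2 : mink (a - b) (conj_vec (a + b)) = 0.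
  rewrite minkDl minkNl conj_vecD !minkDr a2 b2 -mink_conjl (minkC (conj_vec a) b).
  ring.
move: e1 e2; rewrite dE !minkDl !minkZl mink_conj mink_conjl -/m -/m' => e1 e2.
have f1 : (l + k) * (m + m') = 0 by rewrite -(addr0 0) -{1}e1 -e2; ring.
have f2 : (l - k) * (m' - m) = 0 by rewrite -(subr0 0) -{1}e2 -e1; ring.
move/eqP: f1; rewrite mulf_eq0 (gt_eqF h1) orbF => /eqP f1.
move/eqP: f2; rewrite mulf_eq0 (gt_eqF h2) orbF => /eqP f2.
have l0 : l = 0 by lra.
have k0 : k = 0 by lra.
by apply/eqP; rewrite -subr_eq0 dE l0 k0 !scale0r addr0.
Qed.

(** The second clause makes [fun z => z *m L] injective on the sphere product
    near [y], by [sphere_chart]. *)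
Definition left_inverse_mx (y : E) (B : 'M[R]_(p + q, p.+1 + q.+1))
    (L : 'M[R]_(p.+1 + q.+1, p + q)) :=
  B *m L = 1%:M /\ forall d : E, d *m L = 0 -> tproj y d = 0.

Lemma left_inverse_exists (y : E) (B : 'M[R]_(p + q, p.+1 + q.+1)) :
  S y -> (forall i, tangent y (row i B)) -> \rank B = (p + q)%N ->
  exists L, left_inverse_mx y B L.
Proof.
move=> Sy tB rB; have [C FC] := orthonormal_frame_exists Sy.
have [P uP BP] := frame_change FC tB rB.
exists (J *m C^T *m sign_mx p q *m invmx P); split.
  have -> : B *m (J *m C^T *m sign_mx p q *m invmx P) =
     P *m (C *m (J *m C^T *m sign_mx p q)) *m invmx P by rewrite BP !mulmxA.
  by rewrite (frameK FC) mulmx1 mulmxV.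
move=> d; rewrite mulmxA => Hd; have [_ _ <-] := FC.
have uP' : invmx P \in unitmx by rewrite unitmx_inv.
by rewrite -[d *m _](mulmxK uP') Hd !mul0mx.
Qed.

Section local_inversion.
Context (n : 'rV[R]_(p + q) -> E) (u : 'rV[R]_(p + q)).
Hypothesis Cn : Ck_at 1 n u.
Hypothesis Sn : \forall v \near u, S (n v).
Hypothesis rn : \rank (jacobian n u) = (p + q)%N.

Let Snu : S (n u) := nbhs_singleton Sn.

Lemma Gauss_left_inverse : exists L, left_inverse_mx (n u) (jacobian n u) L.
Proof.
apply: left_inverse_exists => // i; exact: (Gauss_tangent Sn (Ck_at_diff Cn)).
Qed.

Context (L : 'M[R]_(p.+1 + q.+1, p + q))
  (HL : left_inverse_mx (n u) (jacobian n u) L).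

Lemma Gauss_coordinates_derive i :
  'D_(delta_mx 0 i) (fun v => n v *m L) u = delta_mx 0 i.
Proof.
have dn := Ck_at_diff Cn.
have [_ ->] := derive_mulmxr L (delta_mx 0 i) dn.
by rewrite -row_jacobian // -row_mul HL.1 row1.
Qed.

(** In the coordinates [L] the Gauss map is a small perturbation of the
    identity; hence it expands and is onto a neighbourhood. *)
Lemma Gauss_inversion (P : set 'rV[R]_(p + q)) : (\forall v \near u, P v) ->
  exists r : R, [/\ 0 < r, (forall v, `|v - u| <= r -> P v),
    (forall x y, `|x - u| <= r -> `|y - u| <= r ->
       `|x - y| <= 2 * `|n x *m L - n y *m L|) &
    exists2 d : R, 0 < d & forall z, S z -> `|z - n u| <= d ->
      exists2 x, `|x - u| <= r & n x = z].
Proof.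
move=> nP.
pose y0 := n u.
(* [m1] and [m2] are, up to a factor, the products of the components of [y]
   with those of [n u]; see [sphere_chart]. *)
pose m1 (y : E) := mink y0 y + mink y0 (conj_vec y).
pose m2 (y : E) := mink y0 (conj_vec y) + -1 * mink y0 y.
have [z0 z2] := (sphereP y0).1 Snu.
have c1 : Ck_at 0 m1 y0.
  by apply: Ck_at_add; apply: Ck_at_mink; try exact: Ck_at_cst;
    [exact: Ck_at_id|apply: Ck_at_conj; exact: Ck_at_id].
have c2 : Ck_at 0 m2 y0.
  apply: Ck_at_add; last apply: Ck_at_mul; try exact: Ck_at_cst; apply: Ck_at_mink;
   try exact: Ck_at_cst; by [exact: Ck_at_id|apply: Ck_at_conj; exact: Ck_at_id].
have pos1 : \forall y \near y0, 0 < m1 y.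
  by apply: (@cvgr_gt _ _ (nbhs y0) _ m1 (m1 y0) (nbhs_singleton c1));
    rewrite /m1 z0 z2; lra.
have pos2 : \forall y \near y0, 0 < m2 y.
  by apply: (@cvgr_gt _ _ (nbhs y0) _ m2 (m2 y0) (nbhs_singleton c2));
    rewrite /m2 z0 z2; lra.
have pos : \forall y \near y0, 0 < m1 y /\ 0 < m2 y by exact: filterI.
have cn : n v @[v --> u] --> n u by exact: (nbhs_singleton (Ck_at_continuous Cn)).
have posn : \forall v \near u, 0 < m1 (n v) /\ 0 < m2 (n v) := cn _ pos.
pose G v := n v *m L.
have CG : Ck_at 1 G u by apply: Ck_at_mulmx => //; exact: Ck_at_cst.
have [r r0 [Hr HG]] := strict_differentiability CG Gauss_coordinates_derive
  (filterI nP (filterI Sn posn)).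
exists r; split=> //.
- by move=> v /Hr[[]].
- by move=> x y xr yr; apply: near_identity_expands; exact: HG.
have [d1 d10 Hd1] := closed_ball_near pos.
have [c c0 Hc] := mulmxr_bound L.
exists (Num.min d1 (r / 5 / c)).
  by rewrite lt_min d10 !divr_gt0.
move=> z Sz; rewrite le_min => /andP[zd1 zr].
have cG v : `|v - u| <= r -> {for v, continuous G}.
  by move=> /Hr[_ dG]; exact: differentiable_continuous.
have zL : `|z *m L - G u| <= r / 5.
  by rewrite /G -mulmxBl; apply: (le_trans (Hc _)); rewrite mulrC -ler_pdivlMr.
have [x xr Gx] := near_identity_onto r0 cG HG zL.
exists x => //; have [[_ [Sx [p1 p2]]] _] := Hr _ xr; have [q1 q2] := Hd1 _ zd1.
move: p1 p2 q1 q2; rewrite /m1 /m2 => p1 p2 q1 q2.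
apply: (@sphere_chart y0) => //.
- by rewrite conj_vecD !minkDr; lra.
- by rewrite conj_vecD !minkDr; lra.
- by apply: HL.2; rewrite mulmxBl; apply/eqP; rewrite subr_eq0; apply/eqP.
Qed.

End local_inversion.

(** In the coordinates [L] the equation [n (K z) = retract z] has as many
    unknowns as equations, and [Ck_at_implicit] applies. *)
Lemma Gauss_inverse_smooth k (n : 'rV[R]_(p + q) -> E) (K : E -> 'rV[R]_(p + q)) y :
  let u := K y in
  Ck_at k.+1 n u -> (\forall v \near u, S (n v)) ->
  \rank (jacobian n u) = (p + q)%N -> S y ->
  (\forall z \near y, n (K z) = retract z /\ {for z, continuous K}) ->
  Ck_at k.+1 K y.
Proof.
move=> u Cn Sn rn Sy HK.
have C1 : Ck_at 1 n u := Ck_at_le (isT : (1 <= k.+1)%N) Cn.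
have [L HL] := Gauss_left_inverse C1 Sn rn.
have [r [r0 _ ex _]] := Gauss_inversion C1 Sn HL (near_always u (fun=> I)).
apply: (@Ck_at_implicit _ _ _ _ (fun v => n v *m L) K (fun z => retract z *m L) y
  r 2) => //.
- by apply: Ck_at_mulmx => //; exact: Ck_at_cst.
- by apply: Ck_at_mulmx; [exact: Ck_at_retract|exact: Ck_at_cst].
- have -> : jacobian (fun v => n v *m L) u = 1%:M; last exact: unitmx1.
  have [dL _] := derive_mulmxr L 0 (Ck_at_diff C1).
  by apply/row_matrixP => i;
    rewrite row_jacobian // (Gauss_coordinates_derive C1 HL) row1.
- by apply: filterS HK => z [-> _].
- by apply: filterS HK => z [].
Qed.

End Gauss_map.

(** * Recovering the potential from a marginally trapped submanifold *)

Section near_equality.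
Context (R : realType) (p q : nat).
Implicit Types (F G : 'rV[R]_(p + q) -> 'rV[R]_(p.+1 + q.+1)) (u : 'rV[R]_(p + q)).

Lemma jacobian_near_eq F G u :
  (\forall v \near u, F v = G v) -> differentiable F u ->
  jacobian G u = jacobian F u.
Proof.
move=> FG dF; have [_ H] := near_eq_diff FG dF.
exact: (congr1 (fun g : 'rV[R]_(p + q) -> 'rV[R]_(p.+1 + q.+1) => lin1_mx g) H).
Qed.

Lemma metric_near_eq F G u : (\forall v \near u, F v = G v) -> differentiable F u ->
  metric G u = metric F u.
Proof. by move=> FG dF; rewrite !metricE (jacobian_near_eq FG dF). Qed.

Lemma mean_curvature_near_eq F G u :
  (\forall v \near u, F v = G v) -> differentiable F u ->
  mean_curvature G u = mean_curvature F u.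
Proof.
move=> FG dF.
pose mc (g : 'M[R]_(p + q)) (w : 'M[R]_(p + q,
  p.+1 + q.+1)) d : 'rV[R]_(p.+1 + q.+1) :=
  ((p + q)%:R : R)^-1 *: \sum_i \sum_j invmx g i j *:
    (d i j - \sum_k \sum_l (invmx g k l * mink (d i j) (row l w)) *: row k w).
have mcE H : mean_curvature H u = mc (metric H u) (jacobian H u)
    (fun i j => 'D_(delta_mx 0 j) ('D_(delta_mx 0 i) H) u) by [].
rewrite !mcE; apply: f_equal3.
- exact: metric_near_eq.
- exact: jacobian_near_eq.
- apply/funext => i; apply/funext => j.
  apply: near_eq_derive; apply: filterS (near_join FG) => v FGv.
  by apply/esym; exact: near_eq_derive.
Qed.

End near_equality.

Section converse.
Context (R : realType) (p q : nat) (T : topologicalType).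
Local Notation E := 'rV[R]_(p.+1 + q.+1).
Local Notation S := (sphere_prod R p q).
Local Notation D := 'rV[R]_(p + q).
Context (pi : T -> E) (cpi : covering_map S pi).
Context (X : topologicalType) (f nu : X -> E).
Hypothesis tf : marginally_trapped_submanifold f.
Hypothesis Gf : mean_Gauss_map f nu.
Hypothesis rnu : maximal_rank f nu.
Hypothesis hn : (0 < p + q)%N.

(** The values that [f = t nu + s conj_vec nu + 2 grad s] forces on [s] and [t],
    by pairing with [nu] and with [conj_vec nu]. *)
Definition potential (x : X) : R := 2^-1 * mink (f x) (nu x).
Definition radius (x : X) : R := 2^-1 * mink (f x) (conj_vec (nu x)).

Lemma chart_inverse k (U : set D) (c : D -> X) : local_param f k U c ->
  exists ci : X -> D, forall u, U u -> ci (c u) = u /\ {for c u, continuous ci}.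
Proof.
move=> [oU injc cc opn _].
pose ci x := xget 0 [set u | U u /\ c u = x].
have ciE u : U u -> ci (c u) = u.
  move=> Uu; rewrite /ci; case: xgetP => [v _ [Uv cv]|/(_ u)]; last by case.
  by apply: injc => //; rewrite inE.
exists ci => u Uu; split; first exact: ciE.
move=> A; rewrite ciE // => /near_within[B [oB Bu BA]].
have oBU : open (c @` (B `&` U)) by apply: opn; [exact: openI|move=> ? []].
have n1 : nbhs (c u) (c @` (B `&` U)) by apply: open_nbhs_nbhs; split=> //;
  exists u.
by rewrite /= /nbhs /=; apply: filterS n1 => _ [v [Bv Uv] <-] /=; rewrite ciE //;
  exact: BA.
Qed.

Section chart.
Context (U : set D) (c : D -> X).
Hypothesis Hc : local_param f 4 U c.
Local Notation F := (f \o c).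
Local Notation n := (nu \o c).

Lemma chart_open : open U. Proof. by case: Hc. Qed.

Lemma chart_near u : U u -> \forall v \near u, U v.
Proof. by move=> Uu; apply: open_nbhs_nbhs; split=> //; exact: chart_open. Qed.

Lemma chart_smooth u : U u -> Ck_at 4 F u.
Proof. by have [_ _ _ _ [CF _]] := Hc; move/(Ck_atP _ _ chart_open): CF; exact. Qed.

Lemma chart_sphere u : U u -> S (n u).
Proof. by move=> Uu; have [] := Gf Hc Uu. Qed.

Lemma chart_normal u i : U u -> mink (n u) ('D_(delta_mx 0 i) F u) = 0.
Proof.
move=> Uu; have [_ H _] := Gf Hc Uu; have := H i.
by rewrite (row_jacobian i (Ck_at_diff (chart_smooth Uu))).
Qed.

Lemma chart_curvature u : U u -> mink (mean_curvature F u) (n u) = 0.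
Proof.
move=> Uu; have [/sphereP[n0 _] _ [a ->]] := Gf Hc Uu.
by rewrite minkZl /= n0 mulr0.
Qed.

Lemma chart_metric u : U u -> metric F u \in unitmx.
Proof.
by move=> Uu; have [_ sg _] := tf.2 _ _ Hc _ Uu; exact: has_signature_unit.
Qed.

Lemma chart_Gauss_smooth u : U u -> Ck_at 3 n u.
Proof.
move=> Uu; apply: (Gauss_smooth (chart_smooth Uu)).
apply: filterS (chart_near Uu) => v Uv; split.
- exact: chart_sphere.
- by have [] := rnu Hc Uv.
- exact: chart_metric.
- by move=> i; exact: chart_normal.
Qed.

Lemma chart_rank u : U u -> \rank (jacobian n u) = (p + q)%N.
Proof. by move=> Uu; have [] := rnu Hc Uu. Qed.

Lemma chart_sphere_near u : U u -> \forall v \near u, S (n v).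
Proof. by move=> Uu; apply: filterS (chart_near Uu) => v; exact: chart_sphere. Qed.

Lemma chart_normal_dir u x : U u -> mink ('D_x F u) (n u) = 0.
Proof.
move=> Uu; have dF := Ck_at_diff (chart_smooth Uu).
rewrite (deriveE _ dF) [X in 'd _ _ X]row_sum_delta linear_sum mink_suml big1 //
  => i _.
by rewrite linearZ /= minkZl minkC -(deriveE _ dF) chart_normal ?mulr0.
Qed.

(** The domain is the part of [T] above a small ball: there the Gauss map has a
    Lipschitz inverse with values in the chart. *)
Lemma Gauss_param_chart (u0 : D) (w0 : T) : U u0 -> pi w0 = n u0 ->
  exists (Om : set T) (h : T -> X), [/\ Gauss_param nu pi Om h,
    Om w0 & h w0 = c u0].
Proof.
move=> Uu0 piw.
have C3 := chart_Gauss_smooth Uu0; have C1 := Ck_at_le (isT : (1 <= 3)%N) C3.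
have Sn := chart_sphere_near Uu0; have rn := chart_rank Uu0.
have [L HL] := Gauss_left_inverse C1 Sn rn.
have [r [r0 rU ex [d d0 onto]]] := Gauss_inversion C1 Sn HL (chart_near Uu0).
pose k z := xget u0 [set v | `|v - u0| <= r /\ n v = z].
pose Om := [set w | `|pi w - n u0| < d].
have kP w : Om w -> `|k (pi w) - u0| <= r /\ n (k (pi w)) = pi w.
  move=> Ow; have [v vr nv] := onto _ (covering_sphere cpi w) (ltW Ow).
  by rewrite /k; case: xgetP => [v' _ //|/(_ v)]; case.
have nOm w : Om w -> \forall v \near w, Om v.
  move=> Ow; have cd : (fun v => `|pi v - n u0|) v @[v --> w] --> `|pi w - n u0|.
    apply: (@continuous_comp _ _ _ (fun v => pi v - n u0) (fun z => `|z|)).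
      by apply: continuousB;
        [exact: (covering_continuous cpi)|exact: cst_continuous].
    exact: norm_continuous.
  exact: (@cvgr_lt _ _ (nbhs w) _ _ _ cd).
have Ow0 : Om w0 by rewrite /Om /= piw subrr normr0.
exists Om, (fun w => c (k (pi w))); split=> //; last first.
  congr c; have [kr nk] := kP _ Ow0.
  have u0r : `|u0 - u0| <= r by rewrite subrr normr0 ltW.
  have := ex _ _ kr u0r; rewrite nk piw subrr normr0 mulr0 normr_le0 subr_eq0.
  by move/eqP.
split.
- by rewrite openE => w Ow; exact: nOm.
- move=> w Ow; have [kr nk] := kP _ Ow.
  apply: (@continuous_comp _ _ _ (fun v => k (pi v)) c); last first.
    by have [_ _ cc _ _] := Hc; apply: cc; exact: rU.
  have [cL cL0 HcL] := mulmxr_bound L.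
  have : k (pi v) @[v --> w] --> k (pi w); last by [].
  apply/cvgrPdist_le => e e0.
  have e1 : 0 < e / (2 * cL) by rewrite divr_gt0 // mulr_gt0.
  have cpw : pi v @[v --> w] --> pi w by exact: (covering_continuous cpi).
  have /cvgrPdist_le/(_ _ e1) Hpi := cpw.
  apply: filterS2 (nOm _ Ow) Hpi => v Ov pv; have [vr nv] := kP _ Ov.
  apply: (le_trans (ex _ _ kr vr)); rewrite nk nv -mulmxBl.
  have -> : e = 2 * (cL * (e / (2 * cL))) by field; rewrite gt_eqF.
  rewrite ler_pM2l //; apply: (le_trans (HcL _)); by rewrite ler_pM2l.
- by move=> w Ow; have [_ nk] := kP _ Ow.
Qed.

End chart.

Section at_point.
Context (Om : set T) (h : T -> X) (w0 : T) (U : set D) (c : D -> X) (u0 : D).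
Hypothesis GP : Gauss_param nu pi Om h.
Hypothesis Ow0 : Om w0.
Hypothesis Hc : local_param f 4 U c.
Hypothesis Uu0 : U u0.
Hypothesis cu0 : c u0 = h w0.
Context (ci : X -> D) (l : E -> T).
Hypothesis Hci : forall u, U u -> ci (c u) = u /\ {for c u, continuous ci}.
Hypothesis lpi : \forall v \near w0, l (pi v) = v.
Hypothesis ll : \forall z \near pi w0, pi (l z) = retract z /\ {for z,
  continuous l}.

Local Notation F := (f \o c).
Local Notation n := (nu \o c).
Local Notation y0 := (pi w0).
Local Notation s := (potential \o h).
Local Notation t := (radius \o h).
(** The chart coordinates of the point of Gauss image [z], extended to a
    neighbourhood of the sphere product by the retraction. *)
Let K (z : E) : D := ci (h (l z)).

Let Sy0 : S y0 := covering_sphere cpi w0.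
Let ly0 : l y0 = w0 := nbhs_singleton lpi.

Lemma Om_near w : Om w -> \forall v \near w, Om v.
Proof. by move=> Ow; have [oOm _ _] := GP; exact: open_nbhs_nbhs. Qed.

Lemma lift_near (P : set T) : (\forall v \near w0, P v) -> \forall z \near y0, P
  (l z).
Proof.
move=> nP; have [_ cl] := nbhs_singleton ll.
have cl' : l z @[z --> y0] --> w0 by rewrite -[X in _ --> X]ly0; exact: cl.
exact: cl' nP.
Qed.

Lemma image_near : \forall v \near w0, Om v /\ (c @` U) (h v).
Proof.
have oc : open (c @` U) by have [oU _ _ opn _] := Hc; exact: opn.
have [_ hc _] := GP; have ch := hc _ Ow0.
have nc : nbhs (h w0) (c @` U) by apply: open_nbhs_nbhs; split=> //; exists u0.
have hcU : \forall v \near w0, (c @` U) (h v) := ch _ nc.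
by apply: filterI => //; exact: Om_near.
Qed.

Lemma K_near : \forall z \near y0, [/\ U (K z), c (K z) = h (l z), n
  (K z) = retract z &
  {for z, continuous K}].
Proof.
have [_ hc nuh] := GP.
apply: filterS2 (lift_near image_near) ll => z [Olz [u Uu cu]] [pil cl].
have [ciu cci] := Hci Uu.
have KE : K z = u by rewrite /K -cu ciu.
rewrite KE; split; [exact: Uu|exact: cu|by rewrite /= cu nuh|].
apply: (@continuous_comp _ _ _ l (ci \o h)); first exact: cl.
by apply: (@continuous_comp _ _ _ h ci); [exact: hc|rewrite -cu].
Qed.

Lemma K_base : K y0 = u0.
Proof. by rewrite /K ly0 -cu0; have [] := Hci Uu0. Qed.

Lemma K_smooth : Ck_at 3 K y0.
Proof.
apply: (@Gauss_inverse_smooth _ _ _ 2 n) => //; rewrite ?K_base.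
- exact: (chart_Gauss_smooth Hc Uu0).
- exact: (chart_sphere_near Hc Uu0).
- exact: (chart_rank Hc Uu0).
- by apply: filterS K_near => z [].
Qed.

Let s_ext (z : E) : R := 2^-1 * mink (F (K z)) (retract z).
Let t_ext (z : E) : R := 2^-1 * mink (F (K z)) (conj_vec (retract z)).

Lemma FK_smooth : Ck_at 3 (F \o K) y0.
Proof.
apply: Ck_at_comp K_smooth _; rewrite K_base.
exact: (Ck_at_le (isT : (3 <= 4)%N) (chart_smooth Hc Uu0)).
Qed.

(** As [n] is normal to the submanifold, only the retraction is
    differentiated: this is why the potential gains one order. *)
Lemma derive_s_ext : \forall z \near y0, differentiable s_ext z /\
  forall x, 'D_x s_ext z = 2^-1 * mink (F (K z)) ('D_x (retract (q := q)) z).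
Proof.
have [dK _] := K_smooth; have [dr _] := Ck_at_retract 1 Sy0.
apply: filterS2 (filterI dK dr) K_near => z [dKz drz] [UK cK nK _].
have dF : differentiable F (K z) := Ck_at_diff (chart_smooth Hc UK).
have dFK : differentiable (F \o K) z := differentiable_comp dKz dF.
have dh := differentiable_cst (2^-1 : R) z.
have D x : differentiable s_ext z /\ 'D_x s_ext z = 2^-1 * mink (F (K z)) ('D_x
  (retract (q := q)) z).
  have [dm Dm] := derive_mink x dFK drz.
  have [ds Ds] := derive_mul x dh dm.
  split; first exact: ds.
  rewrite [LHS]Ds derive_cst mul0r add0r Dm (derive_comp x dKz dF) -nK.
  by rewrite (chart_normal_dir Hc) // add0r.
by split=> [|x]; [have [] := D 0|have [] := D x].
Qed.

Lemma potential_ext : local_ext pi 4 s w0 s_ext.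
Proof.
apply/local_extP; split.
  split; first by apply: filterS derive_s_ext => z [].
  move=> i.
  have H : Ck_at 3 (fun z => 2^-1 * mink (F (K z)) ('D_(delta_mx 0 i) (retract (q
    := q)) z)) y0.
    apply: Ck_at_mul; first exact: Ck_at_cst.
    apply: Ck_at_mink; first exact: FK_smooth.
    by have [_] := Ck_at_retract 4 Sy0; exact.
  by apply: Ck_at_near_eq H; apply: filterS derive_s_ext => z [_ ->].
have cp : pi v @[v --> w0] --> y0 by exact: (covering_continuous cpi).
have Kn : \forall v \near w0, c (K (pi v)) = h (l (pi v)).
  have Kc : \forall z \near y0, c (K z) = h (l z) by apply: filterS K_near => z [].
  exact: cp _ Kc.
have [_ _ nuh] := GP.
apply: filterS2 (filterI Kn lpi) (Om_near Ow0) => v [Kv lv] Ov.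
by rewrite /s_ext /= Kv lv (retract_id (covering_sphere cpi v)) /potential (nuh _
  Ov).
Qed.

Lemma radius_ext : local_ext pi 2 t w0 t_ext.
Proof.
apply/local_extP; split.
  apply: Ck_at_mul; first exact: Ck_at_cst.
  apply: Ck_at_mink; first exact: (Ck_at_le (isT : (2 <= 3)%N) FK_smooth).
  by apply: Ck_at_conj; exact: Ck_at_retract.
have cp : pi v @[v --> w0] --> y0 by exact: (covering_continuous cpi).
have Kn : \forall v \near w0, c (K (pi v)) = h (l (pi v)).
  have Kc : \forall z \near y0, c (K z) = h (l z) by apply: filterS K_near => z [].
  exact: cp _ Kc.
have [_ _ nuh] := GP.
apply: filterS2 (filterI Kn lpi) (Om_near Ow0) => v [Kv lv] Ov.
by rewrite /t_ext /= Kv lv (retract_id (covering_sphere cpi v)) /radius (nuh _ Ov).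
Qed.

(** The gradient of the potential is half the tangential part of [f]. *)
Lemma phi_potential : f (h w0) = phi pi s t w0.
Proof.
have [_ _ nuh] := GP.
have Hs := local_ext_le (isT : (1 <= 4)%N) potential_ext.
have G : 2 *: grad pi s w0 = tproj y0 (f (h w0)).
  apply/eqP; rewrite -subr_eq0; apply/eqP; apply: mink_nondeg => v.
  rewrite minkDl minkNl minkZl (grad_mink _ Hs).
  rewrite (tderiv_ext cpi Hs (tproj_tangent Sy0 _)).
  have [_ ->] := nbhs_singleton derive_s_ext.
  rewrite derive_retract // (tproj_id (tproj_tangent Sy0 _)) /= K_base cu0
    tproj_sym.
  by rewrite mulrA divff // mul1r subrr.
rewrite /phi G tprojE /= /potential /radius (nuh _ Ow0).
rewrite [_ / 2]mulrC [mink (f (h w0)) y0 / 2]mulrC.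
by apply/rowP => i; rewrite !mxE; ring.
Qed.

(** Both [u] and [K (n u)] have the Gauss image [n u], so they are equal near
    [u0], where the Gauss map is injective. *)
Lemma lift_chart : \forall u \near u0,
  [/\ pi (l (n u)) = n u, {for u, continuous (l \o n)},
    Om (l (n u)) & h (l (n u)) = c u].
Proof.
have [_ _ nuh] := GP.
have C3 := chart_Gauss_smooth Hc Uu0; have C1 := Ck_at_le (isT : (1 <= 3)%N) C3.
have Sn := chart_sphere_near Hc Uu0; have rn := chart_rank Hc Uu0.
have n0 : n u0 = y0 by rewrite /= cu0 nuh.
have ncont := Ck_at_continuous C1.
have cn : n u @[u --> u0] --> y0 by rewrite -n0; exact: (nbhs_singleton ncont).
have [L HL] := Gauss_left_inverse C1 Sn rn.
have [r [r0 _ ex _]] := Gauss_inversion C1 Sn HL (near_always u0 (fun=> I)).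
have Kr : \forall z \near y0, `|K z - u0| <= r.
  have [_ _ _ cK] := nbhs_singleton K_near.
  have cK' : K z @[z --> y0] --> u0 by rewrite -[X in _ --> X]K_base; exact: cK.
  exact: cK' _ (near_closed_ball u0 r0).
have N1 : \forall u \near u0, pi (l (n u)) = retract (n u) /\ {for n u,
  continuous l} := cn _ ll.
have N2 : \forall u \near u0, [/\ U (K (n u)), c (K (n u)) = h (l (n u)),
  n (K (n u)) = retract (n u) & {for n u, continuous K}] := cn _ K_near.
have N3 : \forall u \near u0, `|K (n u) - u0| <= r := cn _ Kr.
have N4 : \forall u \near u0, Om (l (n u)) := cn _ (lift_near (Om_near Ow0)).
have N5 := near_closed_ball u0 r0.
apply: filterS2 (filterI (filterI N1 N2) (filterI N3 N4)) (filterI (filterI N5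
  Sn) ncont).
move=> u [[[pil cl] [_ cK nK _]] [Kur Olu]] [[ur Snu] cnu].
have rnu' := retract_id Snu.
have Ku : K (n u) = u.
  apply/eqP; rewrite -subr_eq0 -normr_le0.
  by have := ex _ _ Kur ur; rewrite nK rnu' subrr normr0 mulr0.
split; [by rewrite pil|exact: continuous_comp cnu cl|exact: Olu|by rewrite -cK Ku].
Qed.

(** Along the lift of [lift_chart] the immersion is [phi], so that the general
    formulas for its metric and mean curvature can be read backwards. *)
Lemma root_potential : (forall w, Om w -> f (h w) = phi pi s t w) ->
  root_endo pi s t w0 \in unitmx /\ \tr (invmx (root_endo pi s t w0)) = 0.
Proof.
move=> Hphi; have [_ _ nuh] := GP.
have n0 : n u0 = y0 by rewrite /= cu0 nuh.
pose b := l \o n; have b0 : b u0 = w0 by rewrite /b /= -ly0 -n0.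
have C4 := chart_smooth Hc Uu0; have C3 := chart_Gauss_smooth Hc Uu0.
have dF := Ck_at_diff C4; have dn := Ck_at_diff C3.
have FG : \forall u \near u0, F u = (phi pi s t \o b) u.
  by apply: filterS lift_chart => u [_ _ Ob hb]; rewrite /= -Hphi // hb.
have nb : \forall u \near u0, n u = (pi \o b) u.
  by apply: filterS lift_chart => u [pb _ _ _]; rewrite /= pb.
have Hs : local_ext pi 2 s (b u0) s_ext.
  by rewrite b0; exact: (local_ext_le (isT : (2 <= 4)%N) potential_ext).
have Ht : local_ext pi 1 t (b u0) t_ext.
  by rewrite b0; exact: (local_ext_le (isT : (1 <= 2)%N) radius_ext).
have cb : \forall u \near u0, {for u, continuous b}.
  by apply: filterS lift_chart => u [].
have db : \forall u \near u0, differentiable (pi \o b) u.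
  have [dn' _] := C3.
  by apply: filterS2 (near_join nb) dn' => u nbu dnu; have [] :=
    near_eq_diff nbu dnu.
have rb : \rank (jacobian (pi \o b) u0) = (p + q)%N.
  by rewrite (jacobian_near_eq nb dn); exact: (chart_rank Hc Uu0).
have ddb i : differentiable ('D_(delta_mx 0 i) (phi pi s t \o b)) u0.
  have [_ /(_ i) [/nbhs_singleton ddF _]] := C4.
  have FGi : \forall u \near u0,
    'D_(delta_mx 0 i) F u = 'D_(delta_mx 0 i) (phi pi s t \o b) u.
    by apply: filterS (near_join FG) => u; exact: near_eq_derive.
  by have [] := near_eq_diff FGi ddF.
have um := chart_metric Hc Uu0; rewrite -(metric_near_eq FG dF) in um.
have ur : root_endo pi s t (b u0) \in unitmx.
  by rewrite -(phi_metric_unit cpi Hs Ht cb db rb).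
have := phi_curvature cpi Hs Ht cb db rb ddb ur.
rewrite (mean_curvature_near_eq FG dF) -(nbhs_singleton nb) (chart_curvature Hc
  Uu0) mulNr.
move: ur; rewrite b0 => ur /esym/eqP; rewrite oppr_eq0 mulf_eq0 invr_eq0 pnatr_eq0.
by rewrite eqn0Ngt hn /= => /eqP.
Qed.

End at_point.

Lemma Gauss_param_data (Om : set T)
  (h : T -> X) w0 : Gauss_param nu pi Om h -> Om w0 ->
  exists U c u0 ci l, [/\ local_param f 4 U c, U u0 /\ c u0 = h w0,
   (forall u, U u -> ci (c u) = u /\ {for c u, continuous ci}),
   (\forall v \near w0, l (pi v) = v) &
   \forall z \near pi w0, pi (l z) = retract z /\ {for z, continuous l}].
Proof.
move=> GP Ow0; have [_ _ /(_ (h w0)) [U [c [Hc [u0 Uu0 cu0]]]]] := tf.1.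
have [ci Hci] := chart_inverse Hc; have [l [lpi ll]] := retract_lift cpi w0.
by exists U, c, u0, ci, l.
Qed.

Lemma Gauss_param_phi (Om : set T) (h : T -> X) : Gauss_param nu pi Om h ->
  forall w, Om w -> f (h w) = phi pi (potential \o h) (radius \o h) w.
Proof.
move=> GP w Ow.
have [U [c [u0 [ci [l [Hc [Uu0 cu0] Hci lpi ll]]]]]] := Gauss_param_data GP Ow.
exact: (phi_potential GP Ow Hc Uu0 cu0 Hci lpi ll).
Qed.

Lemma Gauss_param_converse (Om : set T) (h : T -> X) : Gauss_param nu pi Om h ->
  [/\ Ck_on pi 4 Om (potential \o h),
      is_root pi Om (potential \o h) (radius \o h),
      forall w, Om w -> f (h w) = phi pi (potential \o h) (radius \o h) w &
      f @` (h @` Om) = phi pi (potential \o h) (radius \o h) @` Om].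
Proof.
move=> GP; have Hphi := Gauss_param_phi GP; split=> //.
- move=> w Ow; have [U [c [u0 [ci [l [Hc [Uu0 cu0] Hci lpi ll]]]]]] :=
  Gauss_param_data GP Ow.
  by eexists; exact: (potential_ext GP Ow Hc Uu0 cu0 Hci lpi ll).
- split=> w Ow; have [U [c [u0 [ci [l [Hc [Uu0 cu0] Hci lpi ll]]]]]] :=
  Gauss_param_data GP Ow.
    by eexists; exact: (radius_ext GP Ow Hc Uu0 cu0 Hci lpi ll).
  exact: (root_potential GP Ow Hc Uu0 cu0 Hci lpi ll Hphi).
- rewrite image_comp; apply/seteqP; split=> _ [w Ow <-]; exists w => //=;
  rewrite ?Hphi //.
Qed.

Lemma Gauss_param_exists x w0 : pi w0 = nu x ->
  exists (Om : set T) (h : T -> X), [/\ Gauss_param nu pi Om h, Om w0 & h w0 = x].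
Proof.
have [_ _ /(_ x) [U [c [Hc [u0 Uu0 <-]]]]] := tf.1.
exact: (Gauss_param_chart Hc Uu0).
Qed.

Lemma sphere_nu x : S (nu x).
Proof.
have [_ _ /(_ x) [U [c [Hc [u0 Uu0 <-]]]]] := tf.1.
exact: (chart_sphere Hc Uu0).
Qed.

(** Near [L x], the composite of [L] with a local Gauss parametrization and the
    identity are lifts of the same map that agree at [L x], hence equal. So [L]
    is open and its inverse is locally a Gauss parametrization. *)
Lemma Gauss_param_lift (L : X -> T) (x0 : X) : continuous L -> injective L ->
  (forall x, pi (L x) = nu x) ->
  exists h : T -> X, (forall x, h (L x) = x) /\ Gauss_param nu pi (range L) h.
Proof.
move=> cL injL piL.
pose h w := xget x0 [set x | L x = w].
have hL x : h (L x) = x.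
  by rewrite /h; case: xgetP => [y _ /= /injL //|/(_ x)]; case.
have loc x : exists k : T -> X, {for L x, continuous k} /\
    \forall w \near L x, L (k w) = w.
  have [Om [k [[oOm ck nuk] Ox kx]]] := Gauss_param_exists (piL x).
  exists k; have ckx := ck _ Ox; split=> //.
  have [W [oW Wx injW]] := covering_injective_near cpi (L x).
  have nW : \forall w \near L x, W w by exact: open_nbhs_nbhs.
  have nOm : \forall w \near L x, Om w by exact: open_nbhs_nbhs.
  have nLk : \forall w \near L x, W (L (k w)).
    have c1 : (L \o k) w @[w --> L x] --> L x.
      have c2 : {for L x, continuous (L \o k)}.
        by apply: (@continuous_comp _ _ _ k L) => //; exact: cL.
      by move: c2; rewrite /prop_for /continuous_at /= kx.
    exact: c1 _ nW.
  apply: filterS2 (filterI nW nOm) nLk => w [Ww Ow] WLk.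
  by apply: injW => //; rewrite piL nuk.
exists h; split=> //; split.
- rewrite openE => _ [x _ <-]; have [k [_ Lk]] := loc x.
  by apply: filterS Lk => w <-; exists (k w).
- move=> _ [x _ <-]; have [k [ck Lk]] := loc x.
  apply: near_eq_continuous ck; apply: filterS Lk => w Lkw.
  by rewrite -[in RHS]Lkw hL.
- by move=> _ [x _ <-]; rewrite hL piL.
Qed.

End converse.

Theorem theorem3 (R : realType) (p q : nat) (hn : (1 <= p + q)%N)
    (T : topologicalType) (pi : T -> 'rV[R]_(p.+1 + q.+1))
    (hpi : universal_covering R (sphere_prod R p q) pi) :
  (forall (Om : set T) (sigma tau : T -> R),
     open Om -> Ck_on pi 4 Om sigma -> is_root pi Om sigma tau ->
     marginally_trapped_immersion pi Om (phi pi sigma tau))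
  /\
  (forall (X : topologicalType) (f nu : X -> 'rV[R]_(p.+1 + q.+1)),
     connected [set: X] -> marginally_trapped_submanifold f ->
     mean_Gauss_map f nu -> maximal_rank f nu ->
     exists s t : X -> R,
       (forall (Om : set T) (h : T -> X), Gauss_param nu pi Om h ->
          [/\ Ck_on pi 4 Om (s \o h),
              is_root pi Om (s \o h) (t \o h),
              forall w, Om w -> f (h w) = phi pi (s \o h) (t \o h) w &
              f @` (h @` Om) = phi pi (s \o h) (t \o h) @` Om])
       /\
       (forall x : X, exists (Om : set T) (h : T -> X),
          Gauss_param nu pi Om h /\ (h @` Om) x)
       /\
       (forall L : X -> T, continuous L -> injective L ->
          (forall x, pi (L x) = nu x) ->
          exists (Om : set T) (sigma tau : T -> R),
            [/\ open Om, Ck_on pi 4 Om sigma, is_root pi Om sigma tau &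
                range f = phi pi sigma tau @` Om])).
Proof.
have [cpi _ _] := hpi; split=> [Om sigma tau|X f nu _ tf Gf rnu].
  exact: phi_immersion.
have sphere_onto x : exists w, pi w = nu x.
  exact: (covering_onto cpi (sphere_nu tf Gf x)).
exists (potential f nu), (radius f nu); split; last split.
- by move=> Om h; exact: Gauss_param_converse.
- move=> x; have [w pw] := sphere_onto x.
  have [Om [h [GP Ow hw]]] := Gauss_param_exists cpi tf Gf rnu pw.
  by exists Om, h; split=> //; exists w.
move=> L cL injL piL; have [[x0 _]|nX] := pselect (exists x : X, True).
  have [h [hL GP]] := Gauss_param_lift cpi tf Gf rnu x0 cL injL piL.
  have [Cs rt _ fE] := Gauss_param_converse cpi tf Gf rnu hn GP.
  exists (range L), (potential f nu \o h), (radius f nu \o h).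
  split=> //; first by have [] := GP.
  rewrite -fE; apply/seteqP; split=> [_ [x _ <-]|_ [x _ <-]]; last by exists x.
  by exists x => //; exists (L x); [exists x|exact: hL].
(* The empty submanifold is the image of the empty domain. *)
exists set0, (fun=> 0), (fun=> 0); split; [exact: open0|by []|by split|].
by apply/seteqP; split=> [_ [x _ <-]|_ [w []]]; case: nX; exists x.
Qed.
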